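(* Let $(M,\omega)$ be a closed Kähler manifold and let $\mathcal C$ carry the Calabi metric. (1) For every $u_0\in\mathcal C$ and $v_0\in T_{u_0}\mathcal C$ the Cauchy problem $D_tu'=0$, $u(0)=u_0$, $u'(0)=v_0$ has a unique solution (on a maximal open interval containing $0$), and it is real analytic in $t$. If $\mathrm{Vol}=\frac14$ and $|v_0|_{u_0}=1$, it is given by $$u(t)=u_0+2\log\Big(\cos t+\frac{v_0}{2}\sin t\Big).$$ (2) For every $u_0\in\mathcal C$ the exponential map $\exp_{u_0}:D_{u_0}\to\mathcal C$ is injective and surjective. (3) There are no conjugate points in $\mathcal C$.
   Context: Let $(M,\omega)$ be a closed Kähler manifold of complex dimension $n$, $\mathrm{Vol}=\int_M\frac{\omega^n}{n!}$, and $\mathcal C=\{u\in C^\infty(M,\mathbb R): \int_M e^u\frac{\omega^n}{n!}=\int_M\frac{\omega^n}{n!}\}$. A smooth curve in $\mathcal C$ is a map $u$ from an interval to $\mathcal C$ such that $(t,p)\mapsto u(t)(p)$ is smooth (and similarly for multi-parameter families); real analytic in $t$ means that $t\mapsto u(t)(p)$ is real analytic for each $p\in M$. The tangent space is $T_u\mathcal C=\{v\in C^\infty(M,\mathbb R):\int_M v e^u\frac{\omega^n}{n!}=0\}$. A smooth section along $u$ is a smooth $v(t,p)$ with $v(t,\cdot)\in T_{u(t)}\mathcal C$. The Calabi metric is $\langle v,w\rangle_u=\int_M vw\,e^u\frac{\omega^n}{n!}$, $|v|_u=\langle v,v\rangle_u^{1/2}$. Its Levi Civita covariant derivative is $D_tv=v'+\frac12vu'+\frac1{2\mathrm{Vol}}\int_Mvu'e^u\frac{\omega^n}{n!}$,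 where $'=\partial/\partial t$. A geodesic is a smooth curve with $D_tu'=0$. Exponential map: $\exp_{u_0}(v)$ is the value at time $t=1$ of the geodesic with initial position $u_0$ and initial velocity $v$; its domain $D_{u_0}\subset T_{u_0}\mathcal C$ is the set of $v$ for which this geodesic is defined (in $\mathcal C$) on $[0,1]$. (When $\mathrm{Vol}=1/4$, $D_{u_0}=\{0\}\cup\{v\ne0: |v|_{u_0}<\operatorname{arccot}(\frac{-\min v}{2|v|_{u_0}})\}$, with $\operatorname{arccot}$ valued in $(0,\pi)$.) Conjugate points: the curvature is $R(u_q,u_r)u_s=(D_qD_r-D_rD_q)u_s=\frac1{4\mathrm{Vol}}(\langle u_r,u_s\rangle_u u_q-\langle u_q,u_s\rangle_u u_r)$, regarded as a tensor. A Jacobi field along a geodesic $u$ is a smooth section $J$ along $u$ with $D_t^2J-R(u',J)u'=0$. Two distinct points $u_0,u_1\in\mathcal C$, joined by a geodesic $u$ with $u(0)=u_0$, $u(t_0)=u_1$, are conjugate if there is a Jacobi field $J$ along $u$, not identically zero, with $J(0)=0$ and $J(t_0)=0$. *)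

(* Defs.v *)
From HB Require Import structures.
From mathcomp Require Import all_boot all_order all_algebra perm.
From mathcomp Require Import all_classical all_reals all_analysis.

Set Implicit Arguments.
Unset Strict Implicit.
Unset Printing Implicit Defensive.

Import Order.TTheory GRing.Theory Num.Theory.
Import numFieldNormedType.Exports.

Local Open Scope classical_set_scope.
Local Open Scope ring_scope.

Section Smoothness.
Context {R : realType}.

(* To be used with [U] open, so that the derivatives in [U] only depend on the
   restriction of [f] to [U]. *)
Fixpoint class_C (V W : normedModType R) (k : nat) (U : set V) (f : V -> W)
    {struct k} : Prop :=
  {in U, continuous f} /\
  (if k is k'.+1 then
     forall v : V, {in U, forall x, derivable f x v} /\
                   class_C k' U (fun x => 'D_v f x)
   else True).

Definition smooth_on (V W : normedModType R) (U : set V) (f : V -> W) : Prop :=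
  forall k, class_C k U f.

Definition analytic_on (A : set R) (f : R -> R) : Prop :=
  forall t0, A t0 -> exists a : R^nat,
    \forall t \near t0, series (fun k => a k * (t - t0) ^+ k) @ \oo --> f t.

End Smoothness.

Section Lebesgue.
Context {R : realType}.

(* Lebesgue integral over R^m of a nonnegative Borel function, as an iterated
   integral (Tonelli). *)
Fixpoint lebesgue_int (m : nat) : ('rV[R]_m -> \bar R) -> \bar R :=
  match m return ('rV[R]_m -> \bar R) -> \bar R with
  | 0%N => fun f => f 0
  | m'.+1 => fun f =>
      (\int[lebesgue_measure]_x
         lebesgue_int (fun y : 'rV[R]_m' =>
           f (row_mx (x%:M : 'M[R]_1) y : 'rV[R]_(1 + m'))))%E
  end.

End Lebesgue.

Section Manifold.
Context {R : realType}.

(* C^n is R^(n + n): the row vector (x_1, .., x_n, y_1, .., y_n) stands for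
   (x_k + i y_k)_k, and [v *m Jmx] stands for i v. *)
Definition Jmx (n : nat) : 'M[R]_(n + n) := block_mx 0 1%:M (- 1%:M) 0.

(* The coefficient of omega^n / n! with respect to
   dx_1 /\ dy_1 /\ .. /\ dx_n /\ dy_n, when omega is the constant 2-form
   1/2 \sum_(i, j) W_ij de_i /\ de_j, where e = (x_1, .., x_n, y_1, .., y_n):
   expand the n-th wedge power and reorder the factors. *)
Definition top_power_coef (n : nat) (W : 'M[R]_(n + n)) : R :=
  (\sum_(s : 'S_(n + n)) (-1) ^+ s *
     \prod_(k < n) W (s (lshift n k)) (s (rshift n k)))
  / (2 ^ n * n`!)%:R.

Record chart (M : Type) (n : nat) := Chart {
  cdom : set M ;
  cmap : M -> 'rV[R]_(n + n) ;
  cinv : 'rV[R]_(n + n) -> M }.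

Definition ccod (M : Type) n (c : chart M n) : set 'rV[R]_(n + n) :=
  cmap c @` cdom c.

Definition is_chart (M : topologicalType) n (c : chart M n) : Prop :=
  [/\ open (cdom c), open (ccod c),
      {in cdom c, continuous (cmap c)}, {in ccod c, continuous (cinv c)} &
      {in cdom c, cancel (cmap c) (cinv c)}].

Definition transition (M : Type) n (c d : chart M n) :
    'rV[R]_(n + n) -> 'rV[R]_(n + n) := cmap d \o cinv c.

Definition overlap (M : Type) n (c d : chart M n) : set 'rV[R]_(n + n) :=
  cmap c @` (cdom c `&` cdom d).

(* The second conjunct of [transition_holo] is the Cauchy-Riemann system.
   [form c x] is the matrix of omega at [cinv c x] in the coordinates of [c]:
   omega(v, w) = v *m form c x *m w^T. *)
Record closed_kahler (n : nat) := ClosedKahler {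
  carrier :> ptopologicalType ;
  carrier_hausdorff : hausdorff_space carrier ;
  carrier_second_countable : @second_countable carrier ;
  carrier_compact : compact [set: carrier] ;
  atlas : set (chart carrier n) ;
  atlas_chart : forall c, atlas c -> is_chart c ;
  atlas_cover : forall p : carrier, exists2 c, atlas c & cdom c p ;
  transition_holo : forall c d, atlas c -> atlas d ->
    smooth_on (overlap c d) (transition c d) /\
    forall x, overlap c d x ->
      Jmx n *m 'J (transition c d) x = 'J (transition c d) x *m Jmx n ;
  form : chart carrier n -> 'rV[R]_(n + n) -> 'M[R]_(n + n) ;
  form_smooth : forall c, atlas c ->
    forall i j, smooth_on (ccod c) (fun x => form c x i j : R^o) ;
  form_pullback : forall c d, atlas c -> atlas d ->
    forall x, overlap c d x ->
      form c x = 'J (transition c d) x *m form d (transition c d x)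
                   *m ('J (transition c d) x)^T ;
  form_skew : forall c, atlas c -> forall x, ccod c x ->
    (form c x)^T = - form c x ;
  form_closed : forall c, atlas c -> forall x, ccod c x ->
    forall i j k : 'I_(n + n),
      'D_(delta_mx 0 i) (fun y => form c y j k : R^o) x
      + 'D_(delta_mx 0 j) (fun y => form c y k i : R^o) x
      + 'D_(delta_mx 0 k) (fun y => form c y i j : R^o) x = 0 ;
  form_J_invariant : forall c, atlas c -> forall x, ccod c x ->
    Jmx n *m form c x *m (Jmx n)^T = form c x ;
  form_J_positive : forall c, atlas c -> forall x, ccod c x ->
    forall v : 'rV[R]_(n + n), v != 0 ->
      0 < (v *m form c x *m (v *m Jmx n)^T) 0 0 }.

Arguments atlas {n} X _ : rename.
Arguments form {n} X _ _ : rename.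

Definition borel (M : ptopologicalType) := g_sigma_algebraType (@open M).

(* The Borel measure induced by the volume form omega^n / n!. The charts cover
   the compact space [X], so this property determines [mu]; it is consistent on
   overlaps by the change of variables formula. *)
Definition is_kahler_volume n (X : closed_kahler n)
    (mu : {measure set (borel X) -> \bar R}) : Prop :=
  forall c, atlas X c -> forall A : set (borel X),
    measurable A -> A `<=` cdom c ->
    mu A = lebesgue_int (fun x =>
             (\1_(cmap c @` A) x * top_power_coef (form X c x))%:E).

End Manifold.

Arguments closed_kahler R n : clear implicits.
Arguments atlas {R n} X _ : rename.
Arguments form {R n} X _ _ : rename.

Section Calabi.
Context {R : realType} {n : nat} (X : closed_kahler R n)
        (mu : {measure set (borel X) -> \bar R}).

Definition smooth_fun (f : X -> R) : Prop :=
  forall c, atlas X c -> smooth_on (ccod c) (f \o cinv c : _ -> R^o).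

Definition Vol : R := fine (mu setT).

Definition calC : set (X -> R) :=
  [set u | smooth_fun u /\ \int[mu]_p expR (u p) = Vol].

Definition tangent (u : X -> R) : set (X -> R) :=
  [set v | smooth_fun v /\ \int[mu]_p (v p * expR (u p)) = 0].

Definition calabi (u v w : X -> R) : R := \int[mu]_p (v p * w p * expR (u p)).

Definition calabi_norm (u v : X -> R) : R := Num.sqrt (calabi u v v).

(* Time-dependent functions are total in [t], but only their values on an
   interval [I] matter. *)
Definition proper_interval (I : set R) : Prop :=
  is_interval I /\ exists a b, [/\ I a, I b & a < b].

(* Smoothness on I x M, where [I] may contain its end points: there is a smooth
   extension to O x M for some open [O] containing [I]. *)
Definition smooth_family (I : set R) (v : R -> X -> R) : Prop :=
  exists (O : set R) (w : R -> X -> R),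
    [/\ open O, I `<=` O,
        forall c, atlas X c ->
          smooth_on (O `*` ccod c)
            (fun tx : R^o * 'rV[R]_(n + n) => w tx.1 (cinv c tx.2) : R^o) &
        forall t, I t -> w t = v t].

(* Time derivative, one-sided at the end points of [I]. *)
Definition ddt (I : set R) (v : R -> X -> R) : R -> X -> R := fun t p =>
  lim ((s - t)^-1 * (v s p - v t p) @[s --> within (I `\ t) (nbhs t)]).

Definition smooth_curve (I : set R) (u : R -> X -> R) : Prop :=
  [/\ proper_interval I, forall t, I t -> calC (u t) & smooth_family I u].

Definition smooth_section (I : set R) (u v : R -> X -> R) : Prop :=
  (forall t, I t -> tangent (u t) (v t)) /\ smooth_family I v.

Definition Dt (I : set R) (u v : R -> X -> R) : R -> X -> R := fun t p =>
  let u' := ddt I u in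
  ddt I v t p + v t p * u' t p / 2
  + (2 * Vol)^-1 * \int[mu]_q (v t q * u' t q * expR (u t q)).

Definition geodesic (I : set R) (u : R -> X -> R) : Prop :=
  smooth_curve I u /\ forall t, I t -> forall p, Dt I u (ddt I u) t p = 0.

Definition cauchy_solution (u0 v0 : X -> R) (I : set R) (u : R -> X -> R) :
    Prop :=
  [/\ I 0, geodesic I u, u 0 = u0 & ddt I u 0 = v0].

Definition exp_dom (u0 : X -> R) : set (X -> R) :=
  [set v | tangent u0 v /\ exists u, cauchy_solution u0 v `[0, 1] u].

(* The value outside [exp_dom u0] is irrelevant. *)
Definition calabi_exp (u0 v : X -> R) : X -> R :=
  xget u0 [set u1 | exists2 u, cauchy_solution u0 v `[0, 1] u & u 1 = u1].

Definition curvature (u a b c : X -> R) : X -> R := fun p =>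
  (4 * Vol)^-1 * (calabi u b c * a p - calabi u a c * b p).

Definition jacobi_field (I : set R) (u J : R -> X -> R) : Prop :=
  smooth_section I u J /\
  forall t, I t -> forall p,
    Dt I u (Dt I u J) t p - curvature (u t) (ddt I u t) (J t) (ddt I u t) p = 0.

Definition conjugate_points (u0 u1 : X -> R) : Prop :=
  [/\ calC u0, calC u1, u0 <> u1 &
   exists (I : set R) (u : R -> X -> R) (t0 : R) (J : R -> X -> R),
     [/\ geodesic I u, I 0 /\ u 0 = u0, I t0 /\ u t0 = u1,
         jacobi_field I u J /\ (exists t p, I t /\ J t p != 0) &
         J 0 = cst 0 /\ J t0 = cst 0]].

End Calabi.

(* Main.v *)
(** The map [u |-> e^(u/2)] sends C into the sphere of radius [sqrt Vol] of L^2 and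
    geodesics to great circles.  If [u] is a geodesic, then [psi_p = e^(u p / 2)]
    solves [psi_p'' = - k(t) psi_p] with [k] independent of [p].  Hence all
    Wronskians are constant and [psi_p(t) = a(t) psi_p(0) + b(t) psi_p'(0)]; the
    constraint [\int psi^2 = Vol] and [a b' - a' b = 1] then force [b' = a] and
    [a' = - beta^2 b], so no integral has to be differentiated.  A Jacobi field [J]
    becomes [xi = J phi], where [phi = psi / psi(0)], and satisfies
    [xi'' = - beta^2 xi - b(t) phi]; tangency and the zeros of [J] at two times less
    than [pi / beta] apart leave only [J = 0].  Injectivity of exp is read off from
    [\int psi(0) psi(1) = Vol cos beta].

    That the volume is positive on open sets comes from the nonvanishing of the
    Pfaffian of omega; its sign need not be computed, because [mu >= 0]. *)

Require Import Defs.
From HB Require Import structures.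
From mathcomp Require Import all_boot all_order all_algebra perm.
From mathcomp Require Import all_classical all_reals all_analysis.
From mathcomp Require Import measurable_realfun.
From mathcomp Require Import ring lra.

Set Implicit Arguments.
Unset Strict Implicit.
Unset Printing Implicit Defensive.

Import Order.TTheory GRing.Theory Num.Theory.
Import numFieldNormedType.Exports.

Local Open Scope classical_set_scope.
Local Open Scope ring_scope.

(** * Positivity of the volume *)

(** Explicit formulas replace existence theory. Every solution is shown to be the great circle
    through [e^(u/2)], and conversely that circle is a geodesic on every proper interval around [0]
    where it stays positive. Uniqueness, the maximal interval and the domain of exp thus become
    statements about the sign of [circ]. The curvature is positive, and on the whole sphere Jacobi
    fields do vanish again after time [pi / beta]. At that time, however, [circ] equals [-1]
    everywhere, so the curve has already left C: conjugate points are excluded by positivity of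
    [e^(u/2)], not by the sign of the curvature. The Jacobi equation is nonlocal, but its integrals
    depend on [t] alone and merge into one forcing [b(t)] of which no regularity is known; the proof
    eliminates [b] rather than solving for it. The integral in [D_t J] is the only one that is
    differentiated in time. Positivity of the volume on open sets serves to get [Vol > 0] and to
    conclude that a nonnegative continuous function with integral zero vanishes. *)

Section MixedPfaffian.
Context {R : realType} {n : nat}.

(* For [M] constant this is the sum in [top_power_coef]; one matrix for each factor
   makes it multilinear, so that [A - A^T] can be expanded one factor at a time. *)
Definition mixed_pf (M : 'I_n -> 'M[R]_(n + n)) : R :=
  \sum_(s : 'S_(n + n)) (-1) ^+ s *
    \prod_(k < n) M k (s (lshift n k)) (s (rshift n k)).

(** Composing [s] with the transposition of the two slots of factor [i] exchanges row and column
    index in that factor alone and flips the sign of [s]. *)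
Lemma mixed_pf_tr (M : 'I_n -> 'M[R]_(n + n)) (i : 'I_n) :
  mixed_pf (fun k => if k == i then (M k)^T else M k) = - mixed_pf M.
Proof.
pose t : 'S_(n + n) := tperm (lshift n i) (rshift n i).
rewrite /mixed_pf (reindex_inj (mulgI t)) /= -sumrN.
apply: eq_bigr => s _.
rewrite odd_permM odd_tperm eq_lrshift addTb signrN mulNr.
congr (- (_ * _)); apply: eq_bigr => k _; rewrite !permM.
case: eqP => [->|/eqP ki]; first by rewrite tpermL tpermR mxE.
rewrite !tpermD// ?eq_lrshift ?eq_rlshift ?(inj_eq (@lshift_inj _ _))
  ?(inj_eq (@rshift_inj _ _)) // eq_sym //.
Qed.

Lemma mixed_pf_sub (A : 'M[R]_(n + n)) :
  mixed_pf (fun=> A - A^T) = 2 ^+ n * mixed_pf (fun=> A).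
Proof.
(* Only the first [m] factors are replaced. Each further replacement doubles the sum, since by
   [mixed_pf_tr] the transposed term is the negative of the other. *)
suff H m : (m <= n)%N ->
    mixed_pf (fun k => if (k < m)%N then A - A^T else A)
    = 2 ^+ m * mixed_pf (fun=> A).
  rewrite -(H n)//; apply: eq_bigr => s _; congr (_ * _).
  by apply: eq_bigr => k _; rewrite ltn_ord.
elim: m => [_|m IH mn].
  by rewrite mul1r.
rewrite exprS -mulrA -IH; last exact: ltnW.
set M := fun k : 'I_n => if (k < m)%N then A - A^T else A.
pose i := Ordinal mn.
have -> : mixed_pf (fun k => if (k < m.+1)%N then A - A^T else A) =
   mixed_pf M - mixed_pf (fun k => if k == i then (M k)^T else M k).
  rewrite /mixed_pf -sumrB; apply: eq_bigr => s _; rewrite -mulrBr.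
  congr (_ * _).
  rewrite [LHS](bigD1 i)//= [X in _ = X - _](bigD1 i)//= [X in _ = _ - X](bigD1 i)//=.
  rewrite eqxx /M ltnSn ltnn.
  have e (F : 'I_n -> 'M[R]_(n + n)) : (forall k, k != i -> F k = M k) ->
     \prod_(k < n | k != i) F k (s (lshift n k)) (s (rshift n k)) =
     \prod_(k < n | k != i) M k (s (lshift n k)) (s (rshift n k)).
    by move=> h; apply: eq_bigr => k /h ->.
  rewrite (e (fun k => if (k < m.+1)%N then _ else _)); last first.
    move=> k ki; rewrite /M ltnS leq_eqVlt.
    by have /negPf -> : (k : nat) != m by apply: contra ki => /eqP km; apply/eqP/val_inj.
  rewrite -/M (e (fun k => if k == i then _ else _)); last by move=> k /negPf ->.
  by rewrite -mulrBl !mxE.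
by rewrite mixed_pf_tr opprK mulrDl mul1r.
Qed.

(** A Cauchy-Binet expansion: [f k] is the summation index of the product [U^T *m V] in factor [k],
    and for fixed [f] the sum over [s] is the determinant of the rows of [U] and [V] selected by
    [f]. The remaining sum of squares is [n!], but only its positivity matters below. *)
Lemma mixed_pf_mul (U V : 'M[R]_(n, n + n)) :
  mixed_pf (fun=> U^T *m V) =
  \det (col_mx U V) * \sum_(f : {ffun 'I_n -> 'I_n}) \det (rowsub f (1%:M : 'M[R]_n)) ^+ 2.
Proof.
rewrite mulr_sumr.
under eq_bigr => f _.
  have -> : \det (col_mx U V) * \det (rowsub f (1%:M : 'M[R]_n)) ^+ 2 =
     \det (col_mx (rowsub f U) (rowsub f V)).
    rewrite expr2 -(det_ublock _ 0) mulrC -det_mulmx mul_block_col !mul0mx addr0 add0r.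
    by rewrite !mul_rowsub_mx !mul1mx.
  rewrite /determinant.
  over.
rewrite exchange_big /=; apply: eq_bigr => s _.
rewrite -mulr_sumr; congr (_ * _).
under eq_bigr => k _ do rewrite mxE.
rewrite bigA_distr_bigA /=; apply: eq_bigr => f _.
rewrite big_split_ord /= -big_split /=; apply: eq_bigr => k _.
by rewrite col_mxEu col_mxEd !mxE.
Qed.

Lemma Jmx_orth : Jmx n *m (Jmx n)^T = 1%:M :> 'M[R]_(n + n).
Proof.
rewrite /Jmx tr_block_mx mulmx_block !trmx0 trmx1 raddfN /= trmx1.
by rewrite !mul0mx !mulmx0 !mulmx1 !addr0 !add0r mulNmx mulmxN mul1mx opprK -scalar_mx_block.
Qed.

Lemma trJmx : (Jmx n)^T = - Jmx n :> 'M[R]_(n + n).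
Proof.
by rewrite /Jmx tr_block_mx opp_block_mx !trmx0 raddfN /= trmx1 oppr0 opprK.
Qed.

Section Positive.
Variable W : 'M[R]_(n + n).
Hypothesis Wskew : W^T = - W.
Hypothesis WJ : Jmx n *m W *m (Jmx n)^T = W.
Hypothesis Wpos : forall v : 'rV[R]_(n + n), v != 0 ->
  0 < (v *m W *m (v *m Jmx n)^T) 0 0.

Let JW : Jmx n *m W = - (W *m (Jmx n)^T).
Proof.
have JJ : (Jmx n)^T *m Jmx n = 1%:M :> 'M[R]_(n + n).
  by rewrite trJmx mulNmx -mulmxN -trJmx Jmx_orth.
by rewrite trJmx mulmxN opprK -[in RHS]WJ -(mulmxA (Jmx n *m W)) JJ mulmx1.
Qed.

Let WJsym : (W *m (Jmx n)^T)^T = W *m (Jmx n)^T.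
Proof. by rewrite trmx_mul trmxK Wskew mulmxN JW opprK. Qed.

(* Gram-Schmidt for the Hermitian form whose imaginary part is [W]. *)
Lemma unitary_frame k : (k <= n)%N -> exists V : 'M[R]_(k, n + n),
  V *m W *m V^T = 0 /\ V *m (W *m (Jmx n)^T) *m V^T = 1%:M.
Proof.
elim: k => [_|k IH kn].
  by exists 0; rewrite !mul0mx; split=> //; apply/matrixP => -[].
have [V [V0 V1]] := IH (ltnW kn).
(* The left kernel of [K] consists of the vectors orthogonal to the rows of [V] for both the real
   and the imaginary part of the Hermitian form. These are [2k < 2n] real conditions, so a nonzero
   solution exists. *)
pose K := row_mx (W *m V^T) (W *m (Jmx n)^T *m V^T).
have : kermx K != 0.
  rewrite kermx_eq0 /row_free; apply/negP => /eqP rK.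
  have := rank_leq_col K; rewrite rK leqNgt => /negP; apply.
  by rewrite -addnS leq_add// ltnW.
case/rowV0Pn => v /sub_kermxP + v0; rewrite mul_mx_row.
rewrite -[0]row_mx0 => /eq_row_mx[]; rewrite !mulmxA => vV vJV.
pose c := (v *m W *m (v *m Jmx n)^T) 0 0.
have c0 : 0 < c by exact: Wpos.
pose w := (Num.sqrt c)^-1 *: v.
have wV : w *m W *m V^T = 0 by rewrite -!scalemxAl vV scaler0.
have wJV : w *m (W *m (Jmx n)^T) *m V^T = 0.
  by rewrite mulmxA -!scalemxAl vJV scaler0.
have ww : w *m W *m w^T = 0.
  apply/matrixP => i j; rewrite !ord1 [RHS]mxE.
  have : (w *m W *m w^T)^T = - (w *m W *m w^T).
    by rewrite !trmx_mul trmxK Wskew mulNmx mulmxN mulmxA.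
  by move=> /matrixP/(_ 0 0); rewrite !mxE; lra.
have wJw : w *m (W *m (Jmx n)^T) *m w^T = 1%:M.
  apply/matrixP => i j; rewrite !ord1 [RHS]mxE /w linearZ /= -!scalemxAl -scalemxAr scalerA.
  have -> : v *m (W *m (Jmx n)^T) *m v^T = v *m W *m (v *m Jmx n)^T.
    by rewrite trmx_mul !mulmxA.
  rewrite mxE -/c -invfM -expr2 sqr_sqrtr ?(ltW c0)//.
  by rewrite mulVf ?gt_eqF.
suff: forall C : 'M[R]_(1 + k, n + n), C = col_mx w V ->
    C *m W *m C^T = 0 /\ C *m (W *m (Jmx n)^T) *m C^T = 1%:M.
  by move=> /(_ _ erefl) H; exists (col_mx w V).
move=> _ ->; rewrite tr_col_mx (mul_col_mx w V W) (mul_col_mx w V (W *m _)).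
rewrite !mul_col_row V0 V1 wV wJV ww wJw.
have -> : V *m W *m w^T = 0.
  apply: trmx_inj; rewrite !trmx_mul trmxK Wskew mulNmx mulmxN mulmxA wV oppr0.
  by rewrite trmx0.
have -> : V *m (W *m (Jmx n)^T) *m w^T = 0.
  by apply: trmx_inj; rewrite 2!trmx_mul trmxK WJsym mulmxA wJV trmx0.
by split; [exact: block_mx0 | rewrite -scalar_mx_block].
Qed.

(** The rows of [V] and [V *m Jmx n] form a Darboux basis [P]: in it [W] becomes [Jmx n]. Writing
    [Q] for the transposed inverse of [P] gives [W = A - A^T] with [A] built from the two halves of
    [Q], and the Pfaffian sum is a power of 2 times [\det Q] times a positive number. *)
Lemma top_power_coef_neq0 : top_power_coef W != 0.
Proof.
have [V [V0 V1]] := unitary_frame (leqnn n).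
pose P := col_mx V (V *m Jmx n).
have e1 : V *m W *m (V *m Jmx n)^T = 1%:M by rewrite trmx_mul mulmxA -V1 !mulmxA.
have e2 : V *m Jmx n *m W *m V^T = - 1%:M.
  by rewrite -(mulmxA V) JW mulmxN mulNmx V1.
have e3 : V *m Jmx n *m W *m (V *m Jmx n)^T = 0.
  by rewrite -V0 -[in RHS]WJ trmx_mul !mulmxA.
have PWP : P *m W *m P^T = Jmx n.
  by rewrite /P tr_col_mx mul_col_mx mul_col_row V0 e1 e2 e3.
have JJ : Jmx n *m Jmx n = - 1%:M :> 'M[R]_(n + n).
  by rewrite -[X in _ *m X]opprK -trJmx mulmxN Jmx_orth.
have : P *m - (W *m P^T *m Jmx n) = 1%:M.
  by rewrite mulmxN !mulmxA PWP JJ opprK.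
case/mulmx1_unit => uP _.
pose Q := (invmx P)^T.
have -> : W = Q^T *m Jmx n *m Q.
  rewrite /Q trmxK -PWP !mulmxA mulVmx// mul1mx -mulmxA.
by rewrite -trmx_mul mulVmx// trmx1 mulmx1.
pose A := (usubmx Q)^T *m dsubmx Q.
have -> : Q^T *m Jmx n *m Q = A - A^T.
  rewrite -[in LHS](vsubmxK Q) tr_col_mx mul_row_block !mulmx0 mulmx1 mulmxN mulmx1.
  by rewrite add0r addr0 mul_row_col mulNmx addrC /A trmx_mul trmxK.
rewrite /top_power_coef mulf_neq0 ?invr_eq0 ?pnatr_eq0 -?lt0n ?muln_gt0 ?expn_gt0 ?fact_gt0//.
rewrite -/(mixed_pf (fun=> A - A^T)) mixed_pf_sub mixed_pf_mul vsubmxK.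
rewrite !mulf_neq0 ?expf_neq0//.
  by rewrite -unitfE -unitmxE unitmx_tr unitmx_inv.
rewrite gt_eqF// (bigD1 [ffun i => i])//= ltr_wpDr ?sumr_ge0// => [f _|].
  exact: sqr_ge0.
have -> : rowsub [ffun i => i] (1%:M : 'M[R]_n) = 1%:M.
  by apply/matrixP => i j; rewrite !mxE ffunE.
by rewrite det1 expr1n.
Qed.

End Positive.
End MixedPfaffian.

(** * Iterated Lebesgue integrals of cubes *)

Section LebesgueInt.
Context {R : realType}.

(** The integral of a nonnegative function is a supremum over the simple functions below it, hence
    monotone. In this form it compares iterated integrals without a proof that the inner ones are
    measurable in the outer variable. *)
Lemma ge0_le_integral_nomeas d (T : measurableType d)
    (mu : {measure set T -> \bar R}) (f g : T -> \bar R) :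
  (forall x, 0 <= f x)%E -> (forall x, f x <= g x)%E ->
  (\int[mu]_x f x <= \int[mu]_x g x)%E.
Proof.
move=> f0 fg; have g0 x : (0 <= g x)%E by exact: le_trans (fg x).
rewrite !ge0_integralTE//; apply: ereal_sup_le => _ [h hf <-].
by exists h => //= x; exact: le_trans (fg x).
Qed.

Lemma eq_lebesgue_int m (f g : 'rV[R]_m -> \bar R) :
  f =1 g -> lebesgue_int f = lebesgue_int g.
Proof. by move=> /funext ->. Qed.

Lemma lebesgue_int_ge0 m (f : 'rV[R]_m -> \bar R) :
  (forall x, 0 <= f x)%E -> (0 <= lebesgue_int f)%E.
Proof.
elim: m f => [|m IH] f f0 /=; first exact: f0.
by apply: integral_ge0 => x _; apply: IH.
Qed.

Lemma le_lebesgue_int m (f g : 'rV[R]_m -> \bar R) :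
  (forall x, 0 <= f x)%E -> (forall x, f x <= g x)%E ->
  (lebesgue_int f <= lebesgue_int g)%E.
Proof.
elim: m f g => [|m IH] f g f0 fg /=; first exact: fg.
by apply: ge0_le_integral_nomeas => x; [exact: lebesgue_int_ge0|exact: IH].
Qed.

Lemma lebesgue_intN m (f : 'rV[R]_m -> \bar R) :
  (forall x, 0 <= f x)%E ->
  lebesgue_int (fun x => - f x)%E = (- lebesgue_int f)%E.
Proof.
elim: m f => [//|m IH] f f0 /=.
rewrite -integral_ge0N; last by move=> x _; exact: lebesgue_int_ge0.
by apply: eq_integral => x _; rewrite IH.
Qed.

Lemma ball_row_mx m (x0 : 'rV[R]_(1 + m)) r (x : R) (y : 'rV[R]_m) :
  ball x0 r (row_mx (x%:M : 'M[R]_1) y) <->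
  ball (x0 0 0) r x /\ ball (rsubmx x0) r y.
Proof.
have -> : x0 0 0 = lsubmx x0 0 0 by rewrite mxE; congr (x0 _ _); exact/val_inj.
split.
  move=> [r0 H]; split.
    by have := H 0 (lshift m 0); rewrite row_mxEl !mxE eqxx mulr1n.
  by split=> // i j; have := H i (rshift 1 j); rewrite row_mxEr !mxE.
move=> [H1 [r0 H2]]; split=> // i j.
case: (splitP j) => k jk; rewrite !ord1.
  have -> : j = lshift m k by exact/val_inj.
  by rewrite row_mxEl !ord1 mxE eqxx mulr1n; move: H1; rewrite mxE.
have -> : j = rshift 1 k by exact/val_inj.
by rewrite row_mxEr; have := H2 0 k; rewrite mxE.
Qed.

(** Balls of row vectors are cubes, the norm being the maximum norm. By [ball_row_mx] the indicator
    splits off one coordinate at a time, each contributing the length [r *+ 2]. *)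
Lemma lebesgue_int_ball m (x0 : 'rV[R]_m) (r C : R) : 0 < r -> 0 <= C ->
  lebesgue_int (fun x => (C * \1_(ball x0 r) x)%:E) = (C * (r *+ 2) ^+ m)%:E.
Proof.
move=> r0; elim: m x0 C => [|m IH] x0 C C0 /=.
  by rewrite indicE mem_set ?mulr1 ?expr0 ?mulr1//; split=> // i [].
transitivity (\int[lebesgue_measure]_x
    ((C * (r *+ 2) ^+ m)%:E * (\1_(ball (x0 0 0) r) x)%:E))%E.
  apply: eq_integral => x _.
  transitivity (lebesgue_int (fun y : 'rV[R]_m =>
     (C * \1_(ball (x0 0 0) r) x * \1_(ball (rsubmx (x0 : 'rV_(1 + m))) r) y)%:E)).
    apply: eq_lebesgue_int => y; congr EFin; rewrite -mulrA; congr (_ * _).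
    rewrite !indicE -natrM mulnb; congr (nat_of_bool _)%:R.
    apply/idP/andP; rewrite !inE => /ball_row_mx; exact.
  rewrite IH ?mulr_ge0//.
  by rewrite -EFinM mulrAC.
rewrite ge0_integralZl_EFin//; last 2 first.
- apply/measurable_EFinP; apply: measurable_indic; exact: measurable_ball.
- by rewrite mulr_ge0// exprn_ge0// mulrn_wge0// ltW.
rewrite integral_indic//; last exact: measurable_ball.
rewrite setIT [X in (_ * X)%E](_ : _ = (r *+ 2)%:E); last first.
  exact/lebesgue_measure_ball/ltW.
by rewrite -EFinM exprSr mulrA.
Qed.

End LebesgueInt.

Lemma cvg_prod_seq {T : Type} (F : set_system T) {R : realType} (I : Type)
    (r : seq I) (f : I -> T -> R) (l : I -> R) : Filter F ->
  (forall i, f i x @[x --> F] --> l i) ->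
  \prod_(i <- r) f i x @[x --> F] --> \prod_(i <- r) l i.
Proof.
move=> FF fl; apply: (@cvg_big R^o I _ _ xpredT _ T F r f l) => [|i _]; last exact: fl.
exact: mul_continuous.
Qed.

Lemma cvg_sum_seq {T : Type} (F : set_system T) {R : realType} (I : Type)
    (r : seq I) (f : I -> T -> R) (l : I -> R) : Filter F ->
  (forall i, f i x @[x --> F] --> l i) ->
  \sum_(i <- r) f i x @[x --> F] --> \sum_(i <- r) l i.
Proof.
move=> FF fl; apply: (@cvg_big R^o I _ _ xpredT _ T F r f l) => [|i _]; last exact: fl.
exact: add_continuous.
Qed.

Section KahlerVolume.
Context {R : realType} {n : nat} (X : closed_kahler R n).

Lemma top_power_coef_cvg (c : chart X n) (x : 'rV[R]_(n + n)) :
  atlas X c -> ccod c x ->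
  top_power_coef (Defs.form X c y) @[y --> x] --> top_power_coef (Defs.form X c x).
Proof.
move=> Xc cx; have fc i j : Defs.form X c y i j @[y --> x] --> Defs.form X c x i j.
  have /(_ 0%N)[/(_ x (mem_set cx)) H _] := form_smooth Xc i j.
  exact: H.
have H1 (s : 'S_(n + n)) :
    \prod_(k < n) Defs.form X c y (s (lshift n k)) (s (rshift n k)) @[y --> x] -->
    \prod_(k < n) Defs.form X c x (s (lshift n k)) (s (rshift n k)).
  exact: (@cvg_prod_seq _ (nbhs x) R _ _ (fun k y =>
    Defs.form X c y (s (lshift n k)) (s (rshift n k)))).
have H2 (s : 'S_(n + n)) :
    (-1) ^+ s * \prod_(k < n) Defs.form X c y (s (lshift n k)) (s (rshift n k))
      @[y --> x] -->
    (-1) ^+ s * \prod_(k < n) Defs.form X c x (s (lshift n k)) (s (rshift n k)).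
  exact: (@cvgMl_tmp R _ _ _ _ _ _ (H1 s)).
have H3 := @cvg_sum_seq _ (nbhs x) R _ (index_enum 'S_(n + n)) (fun s y =>
  (-1) ^+ s * \prod_(k < n) Defs.form X c y (s (lshift n k)) (s (rshift n k))) _ (nbhs_filter x) H2.
have H4 := @cvgMr_tmp R _ _ (nbhs_filter x) _ _ (2 ^ n * n`!)%:R^-1 H3.
exact: H4.
Qed.

Lemma top_power_coef_form_neq0 (c : chart X n) (x : 'rV[R]_(n + n)) :
  atlas X c -> ccod c x -> top_power_coef (Defs.form X c x) != 0.
Proof.
move=> Xc cx; apply: top_power_coef_neq0.
- exact: form_skew.
- exact: form_J_invariant.
- exact: form_J_positive.
Qed.

Lemma borel_open (U : set X) : open U -> measurable (U : set (borel X)).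
Proof. exact: sub_sigma_algebra. Qed.

Variable mu : {measure set (borel X) -> \bar R}.
Hypothesis hmu : is_kahler_volume mu.

(** [A] is a coordinate cube on which the density differs from its value at [p] by less than half of
    that value, so [mu A] lies between two positive multiples of the volume of the cube. *)
Lemma volume_nbhs (p : X) (U : set X) : nbhs p U ->
  exists A : set X, [/\ open A, A p, A `<=` U & (0 < mu A < +oo)%E].
Proof.
move=> pU.
have [c Xc cp] := atlas_cover p.
have [oD oC mapC invC mapK] := atlas_chart Xc.
pose x0 := cmap c p.
have cx0 : ccod c x0 by exists p.
pose g x := top_power_coef (Defs.form X c x).
have g0 : g x0 != 0 by exact: top_power_coef_form_neq0.
have [r /= r0 rB] : nbhs_ball x0 (ccod c `&` (cinv c @^-1` U) `&`
     [set x | `|g x0 - g x| < `|g x0| / 2]).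
  apply/nbhs_ballP; apply: filterI; first apply: filterI.
  - exact: open_nbhs_nbhs.
  - have := invC _ (mem_set cx0); apply.
    by rewrite /x0 mapK ?inE.
  - have /cvgrPdist_lt := top_power_coef_cvg Xc cx0; apply.
    by rewrite divr_gt0// normr_gt0.
pose A : set X := cdom c `&` cmap c @^-1` (ball x0 r).
have cA : cmap c @` A = ball x0 r.
  rewrite eqEsubset; split=> [_ [q [_ qb] <-]//|x bx].
  have [[[q cq qx] _] _] := rB _ bx.
  by exists q => //; split=> //; rewrite /preimage/= qx.
have oA : open A.
  rewrite openE => q [cq qb]; apply: filterI; first exact: open_nbhs_nbhs.
  have := mapC _ (mem_set cq); apply.
  by apply: open_nbhs_nbhs; split=> //; exact: ball_open.
have AU : A `<=` U.
  by move=> q [cq /rB[[_]]]; rewrite /preimage /= mapK ?inE.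
have := hmu Xc (borel_open oA) (@subIsetl _ _ _); rewrite cA.
have gB x : ball x0 r x -> `|g x0 - g x| < `|g x0| / 2 by move=> /rB[].
have [gpos|gneg] : 0 < g x0 \/ g x0 < 0.
- by move: g0; rewrite neq_lt => /orP[]; [right|left].
- move=> muA; exists A; split=> //; first by split=> //; exact: ballxx.
  have lo x : (((g x0 / 2) * \1_(ball x0 r) x)%:E <= (\1_(ball x0 r) x * g x)%:E)%E.
    rewrite lee_fin indicE; case: (boolP (x \in _)) => [/set_mem/gB|_]; last by rewrite mulr0 mul0r.
    rewrite mulr1 mul1r (gtr0_norm gpos) ltr_norml; lra.
  have up x : ((\1_(ball x0 r) x * g x)%:E <= ((g x0 * 2) * \1_(ball x0 r) x)%:E)%E.
    rewrite lee_fin indicE; case: (boolP (x \in _)) => [/set_mem/gB|_]; last by rewrite mulr0 mul0r.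
    rewrite mulr1 mul1r (gtr0_norm gpos) ltr_norml; lra.
  have lo0 x : (0%E <= ((g x0 / 2) * \1_(ball x0 r) x)%:E)%E.
    rewrite lee_fin mulr_ge0 ?ler0n//; lra.
  have rpos : 0 < (r *+ 2) ^+ (n + n) by rewrite exprn_gt0// mulrn_wgt0.
  rewrite muA; apply/andP; split.
    apply: (lt_le_trans _ (le_lebesgue_int lo0 lo)).
    have gp : 0 < g x0 / 2 by rewrite divr_gt0.
    by rewrite (lebesgue_int_ball _ r0 (ltW gp)) lte_fin; exact: mulr_gt0.
  apply: (le_lt_trans (le_lebesgue_int (fun x => le_trans (lo0 x) (lo x)) up)).
  rewrite lebesgue_int_ball// ?ltry//; lra.
- (* A negative coefficient would give the small ball negative volume. *)
  move=> muA; exfalso.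
  have : (0 <= mu A)%E by exact: measure_ge0.
  rewrite muA.
  have lo x : (((- g x0 / 2) * \1_(ball x0 r) x)%:E <= (\1_(ball x0 r) x * - g x)%:E)%E.
    rewrite lee_fin indicE; case: (boolP (x \in _)) => [/set_mem/gB|_]; last by rewrite mulr0 mul0r.
    rewrite mulr1 mul1r (ltr0_norm gneg) ltr_norml; lra.
  have lo0 x : (0%E <= ((- g x0 / 2) * \1_(ball x0 r) x)%:E)%E.
    rewrite lee_fin mulr_ge0 ?ler0n//; lra.
  have -> : lebesgue_int (fun x => (\1_(ball x0 r) x * g x)%:E) =
      (- lebesgue_int (fun x => (\1_(ball x0 r) x * - g x)%:E))%E.
    rewrite -lebesgue_intN; last by move=> x; exact: le_trans (lo x).
    by apply: eq_lebesgue_int => x; rewrite -EFinN mulrN opprK.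
  apply/negP; rewrite -ltNge oppe_lt0; apply: (lt_le_trans _ (le_lebesgue_int lo0 lo)).
  have gp : 0 < - g x0 / 2 by rewrite divr_gt0// oppr_gt0.
  have rpos : 0 < (r *+ 2) ^+ (n + n) by rewrite exprn_gt0// mulrn_wgt0.
  by rewrite (lebesgue_int_ball _ r0 (ltW gp)) lte_fin; exact: mulr_gt0.
Qed.

Lemma volume_open_gt0 (U : set X) : open U -> U !=set0 -> (0 < mu U)%E.
Proof.
move=> oU [p Up].
have [A [oA Ap AU /andP[A0 _]]] := volume_nbhs (open_nbhs_nbhs (conj oU Up)).
by apply: (lt_le_trans A0); apply: le_measure => //; rewrite inE; exact: borel_open.
Qed.

(** Compactness extracts finitely many of the open sets of finite measure given by [volume_nbhs];
    subadditivity does the rest. *)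
Lemma volume_fin : (mu setT < +oo)%E.
Proof.
have : cover_compact [set: X] by rewrite -compact_cover; exact: carrier_compact.
move=> /(_ (set X) [set A | open A /\ (mu A < +oo)%E] id)[].
- by move=> A [].
- move=> p _; have [A [oA Ap _ /andP[_ Aoo]]] := volume_nbhs (@filterT _ (nbhs p) _).
  by exists A.
- move=> D DA; rewrite /cover bigcup_fset => TD.
  suff [mD Doo] : measurable (\big[setU/set0]_(i <- finmap.enum_fset D) i : set (borel X)) /\
     (mu (\big[setU/set0]_(i <- finmap.enum_fset D) i) < +oo)%E.
    have := @le_measure _ _ _ mu _ _ (mem_set measurableT) (mem_set mD) TD.
    by move=> H; exact: le_lt_trans H Doo.
  rewrite big_seq.
  apply: (big_ind (fun A : set X => measurable (A : set (borel X)) /\ (mu A < +oo)%E)).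
  - by rewrite measure0.
  - move=> A B [mA Aoo] [mB Boo]; split; first exact: measurableU.
    by apply: (le_lt_trans (measureU2 _ mA mB)); exact: lte_add_pinfty.
  - by move=> A /DA; rewrite inE => -[oA Aoo]; split=> //; exact: borel_open.
Qed.

End KahlerVolume.

(** * Integrals of continuous functions on the compact manifold *)

Section ContinuousOps.
Context {R : realType} {T : topologicalType}.
Implicit Types f g : T -> R.

Lemma contD f g : continuous f -> continuous g -> continuous (fun p => f p + g p).
Proof. by move=> cf cg p; apply: cvgD; [exact: cf|exact: cg]. Qed.

Lemma contM f g : continuous f -> continuous g -> continuous (fun p => f p * g p).
Proof. by move=> cf cg p; apply: cvgM; [exact: cf|exact: cg]. Qed.

Lemma contZ (a : R) f : continuous f -> continuous (fun p => a * f p).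
Proof. by move=> cf; apply: contM => // p; exact: cvg_cst. Qed.

Lemma cont_expR f : continuous f -> continuous (fun p => expR (f p)).
Proof.
by move=> cf p; apply: continuous_comp; [exact: cf|exact: continuous_expR].
Qed.

End ContinuousOps.

Section ContinuousIntegral.
Context {R : realType} {n : nat} (X : closed_kahler R n).
Variable mu : {measure set (borel X) -> \bar R}.
Hypothesis hmu : is_kahler_volume mu.

Lemma continuous_bounded (f : X -> R) : continuous f ->
  exists M, forall p, `|f p| <= M.
Proof.
move=> cf.
have cX := @carrier_compact _ _ X.
have X0 : [set: X] !=set0 by exists point.
have cnf : {within [set: X], continuous (fun p => `|f p|)}.
  apply: continuous_subspaceT => p; apply: continuous_comp; first exact: cf.
  exact: norm_continuous.
have [c _ Hc] := compact_EVT_max X0 cX cnf.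
by exists `|f c| => p; apply: Hc; rewrite inE.
Qed.

Lemma continuous_borel_measurable (f : X -> R) : continuous f ->
  measurable_fun setT (f : borel X -> R).
Proof.
move=> /continuousP cf; apply: (measurability _ (RGenOInfty.measurableE R)).
move=> _ [_ [x ->] <-]; rewrite setTI; apply: borel_open; apply: cf.
exact: interval_open.
Qed.

Lemma continuous_integrable (f : X -> R) : continuous f ->
  mu.-integrable [set: borel X] (EFin \o f).
Proof.
move=> cf; apply: measurable_bounded_integrable => //.
- exact: volume_fin hmu.
- exact: continuous_borel_measurable.
- have [M HM] := continuous_bounded cf.
  exists M; split; first exact: num_real.
  by move=> x Mx p _; apply: le_trans (HM p) _; exact: ltW.
Qed.

Lemma Rint_lin (f g : X -> R) (a b : R) : continuous f -> continuous g ->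
  \int[mu]_p (a * f p + b * g p) =
  a * (\int[mu]_p f p) + b * (\int[mu]_p g p).
Proof.
move=> cf cg.
rewrite RintegralD//; try by apply: continuous_integrable; exact: contZ.
by rewrite !RintegralZl//; exact: continuous_integrable.
Qed.

Lemma Rint_le (f g : X -> R) : continuous f -> continuous g ->
  (forall p, f p <= g p) -> \int[mu]_p f p <= \int[mu]_p g p.
Proof.
by move=> cf cg fg; apply: le_Rintegral => //; exact: continuous_integrable.
Qed.

Lemma Vol_gt0 : 0 < Vol mu.
Proof.
rewrite /Vol fine_gt0// (volume_fin hmu) andbT.
by apply: (volume_open_gt0 hmu openT); exists point.
Qed.

Lemma Rint_cst (a : R) : \int[mu]_p a = a * Vol mu.
Proof. by rewrite Rintegral_cst. Qed.

(** If [f p > 0], then [f] exceeds [f p / 2] on an open set containing [p]. That set has positive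
    measure, so the integral would be positive. *)
Lemma Rint_eq0 (f : X -> R) : continuous f -> (forall p, 0 <= f p) ->
  \int[mu]_p f p = 0 -> forall p, f p = 0.
Proof.
move=> cf f0 intf p; apply/eqP; rewrite eq_le f0 andbT leNgt; apply/negP => fp.
pose U : set X := f @^-1` [set x | f p / 2 < x].
have oU : open U by move/continuousP: cf; apply; exact: open_gt.
have Up : U p by rewrite /U /preimage /=; lra.
have mU : measurable (U : set (borel X)) by exact: borel_open.
have mupos := volume_open_gt0 hmu oU (ex_intro _ p Up).
have muoo : (mu U < +oo)%E.
  by apply: le_lt_trans (volume_fin hmu); apply: le_measure; rewrite ?inE.
have i1 : mu.-integrable [set: borel X] (EFin \o (\1_U : borel X -> R)).
  apply: measurable_bounded_integrable => //; first exact: volume_fin hmu.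
  exists 1; split; first exact: num_real.
  move=> x x1 q _ /=; rewrite indicE; apply: le_trans (ltW x1).
  by case: (_ \in _); rewrite /= ?normr1 ?normr0.
have : \int[mu]_q (f p / 2 * \1_U q) <= \int[mu]_q f q.
  apply: le_Rintegral => //.
  - by have := integrableZl measurableT (f p / 2) i1.
  - exact: continuous_integrable.
  - move=> q _; rewrite indicE; case: (boolP (q \in U)) => [/set_mem|] Uq.
      by rewrite mulr1; exact: ltW.
    by rewrite mulr0.
rewrite intf leNgt => /negP; apply.
rewrite RintegralZl//; 
rewrite /Rintegral integral_indic// setIT mulr_gt0 ?divr_gt0// fine_gt0//.
by rewrite mupos.
Qed.

Lemma Rint_sqr_eq0 (f g : X -> R) : continuous f -> continuous g ->
  (forall p, 0 < g p) -> \int[mu]_p (f p * f p * g p) = 0 -> forall p, f p = 0.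
Proof.
move=> cf cg g0 fg0 p.
have := Rint_eq0 (contM (contM cf cf) cg) _ fg0 p.
move=> H0; have /eqP : f p * f p * g p = 0.
  by apply: H0 => q; apply: mulr_ge0 (ltW (g0 q)); rewrite -expr2 sqr_ge0.
by rewrite !mulf_eq0 orbb (gt_eqF (g0 p)) orbF => /eqP.
Qed.

End ContinuousIntegral.

(** * Calculus of smooth functions *)

Section ClassC.
Context {R : realType}.

Lemma class_CW (V W : normedModType R) k (U : set V) (f : V -> W) :
  class_C k.+1 U f -> class_C k U f.
Proof.
elim: k f => [|k IH] f [cf df]; split=> // v.
by have [dv Cv] := df v; split=> //; exact: IH.
Qed.

Lemma class_C_derivable (V W : normedModType R) k (U : set V) (f : V -> W) x v :
  class_C k.+1 U f -> U x -> derivable f x v.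
Proof. by move=> [_ /(_ v)[df _]] /mem_set; exact: df. Qed.

Lemma class_C_derive (V W : normedModType R) k (U : set V) (f : V -> W) v :
  class_C k.+1 U f -> class_C k U (fun x => 'D_v f x).
Proof. by move=> [_ /(_ v)[]]. Qed.

Lemma class_C_cont (V W : normedModType R) k (U : set V) (f : V -> W) x :
  class_C k U f -> U x -> {for x, continuous f}.
Proof. by case: k => [|k] [cf _] /mem_set; exact: cf. Qed.

Lemma class_CS (V W : normedModType R) k (U : set V) (f : V -> W)
    (df : V -> V -> W) :
  {in U, continuous f} -> (forall v x, U x -> is_derive x v f (df v x)) ->
  (forall v, class_C k U (fun x => 'D_v f x)) -> class_C k.+1 U f.
Proof.
move=> cf dfE Cdf; split=> // v; split=> // x /set_mem Ux.
by have [] := dfE v _ Ux.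
Qed.

(** As [U] is open, functions agreeing on [U] agree near each of its points, so their derivatives
    agree on [U] as well. This is what later allows derivatives to be computed on [U] only. *)
Lemma eq_class_C (V W : normedModType R) k (U : set V) (f g : V -> W) :
  open U -> (forall x, U x -> f x = g x) -> class_C k U f -> class_C k U g.
Proof.
move=> oU; elim: k f g => [|k IH] f g fg [cf df].
- split=> // x /[dup] Ux /set_mem xU; rewrite /continuous_at -(fg _ xU).
  apply: cvg_trans (cf x Ux); apply: near_eq_cvg.
  by near do apply: fg; exact: open_nbhs_nbhs.
- have fgx x : U x -> \forall y \near x, f y = g y.
    by move=> xU; near do apply: fg; exact: open_nbhs_nbhs.
  split=> [x /[dup] Ux /set_mem xU|v].
    rewrite /continuous_at -(fg _ xU).
    apply: cvg_trans (cf x Ux); apply: near_eq_cvg; exact: fgx.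
  have [dv Cv] := df v; split=> [x /[dup] Ux /set_mem xU|].
    by apply: near_eq_derivable (fgx _ xU) _; exact: dv.
  apply: IH Cv => x xU; exact: near_eq_derive (fgx _ xU).
Unshelve. all: by end_near. Qed.

Lemma class_C_is_derive (V W : normedModType R) k (U : set V) (f : V -> W)
    (df : V -> V -> W) :
  open U ->
  {in U, continuous f} -> (forall v x, U x -> is_derive x v f (df v x)) ->
  (forall v, class_C k U (df v)) -> class_C k.+1 U f.
Proof.
move=> oU cf dfE Cdf; apply: (class_CS cf dfE) => v.
by apply: eq_class_C (Cdf v) => // x Ux; have [_ ->] := dfE v x Ux.
Qed.

Lemma class_C_cst (V W : normedModType R) k (U : set V) (a : W) :
  open U -> class_C k U (cst a : V -> W).
Proof.
move=> oU; elim: k a => [|k IH] a; first by split=> // x _; exact: cst_continuous.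
apply: (@class_C_is_derive _ _ _ _ _ (fun _ _ => 0)) => //.
- by move=> x _; exact: cst_continuous.
- by move=> v; exact: (IH 0).
Qed.

Lemma class_CD (V : normedModType R) k (U : set V) (f g : V -> R^o) : open U ->
  class_C k U f -> class_C k U g -> class_C k U (fun x => f x + g x : R^o).
Proof.
move=> oU; elim: k f g => [|k IH] f g Cf Cg.
  by split=> // x /set_mem Ux; apply: continuousD;
    [exact: (class_C_cont Cf Ux)|exact: (class_C_cont Cg Ux)].
apply: (@class_C_is_derive _ _ _ _ _ (fun v x => 'D_v f x + 'D_v g x)) => //.
- by move=> x /set_mem Ux; apply: continuousD;
    [exact: (class_C_cont Cf Ux)|exact: (class_C_cont Cg Ux)].
- move=> v x Ux; 
  exact: (is_deriveD (derivableP (class_C_derivable Cf Ux))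
                    (derivableP (class_C_derivable Cg Ux))).
- by move=> v; apply: IH; exact: class_C_derive.
Qed.

Lemma class_CM (V : normedModType R) k (U : set V) (f g : V -> R^o) : open U ->
  class_C k U f -> class_C k U g -> class_C k U (fun x => f x * g x : R^o).
Proof.
move=> oU; elim: k f g => [|k IH] f g Cf Cg.
  by split=> // x /set_mem Ux; apply: continuousM;
    [exact: (class_C_cont Cf Ux)|exact: (class_C_cont Cg Ux)].
apply: (@class_C_is_derive _ _ _ _ _
  (fun v x => f x * 'D_v g x + g x * 'D_v f x)) => //.
- by move=> x /set_mem Ux; apply: continuousM;
    [exact: (class_C_cont Cf Ux)|exact: (class_C_cont Cg Ux)].
- move=> v x Ux; 
  exact: (is_deriveM (derivableP (class_C_derivable Cf Ux))
                    (derivableP (class_C_derivable Cg Ux))).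
- move=> v; apply: class_CD => //; apply: IH.
  + exact: class_CW.
  + exact: class_C_derive.
  + exact: class_CW.
  + exact: class_C_derive.
Qed.

Lemma class_CN (V : normedModType R) k (U : set V) (f : V -> R^o) : open U ->
  class_C k U f -> class_C k U (fun x => - f x : R^o).
Proof.
move=> oU Cf.
apply: (@eq_class_C _ _ _ _ (fun x => (-1) * f x : R^o)) => //.
  by move=> x _; rewrite mulN1r.
by apply: class_CM => //; exact: class_C_cst.
Qed.

Lemma derive_line (V W : normedModType R) (f : V -> W) x v :
  'D_1 (fun h : R => f (h *: v + x)) 0 = 'D_v f x.
Proof.
rewrite /derive; set g1 := fun h => h^-1 *: _; set g2 := fun h => h^-1 *: _.
suff -> : g1 = g2 by [].
by rewrite funeqE /g1 /g2 => h /=; rewrite addr0 scale0r add0r [_%:A]mulr1.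
Qed.

(** A directional derivative is a one-variable derivative at [0] along a line, which reduces the
    claim to the one-variable chain rule. *)
Lemma is_derive_real_comp (V : normedModType R) (f : V -> R^o) (g : R -> R)
    (x v : V) (df dg : R) :
  is_derive x v f df -> is_derive (f x : R) 1 g dg ->
  is_derive x v (fun y => g (f y) : R^o) (dg * df).
Proof.
move=> [df1 df2] dgx.
pose h := fun t : R => f (t *: v + x) : R.
have dh : is_derive (0 : R) 1 h df.
  apply: DeriveDef; first exact: (derivable1P f x v).1 df1.
  rewrite -df2; exact: (derive_line f x v).
have dgh : is_derive (h 0) 1 g dg by rewrite /h scale0r add0r.
have [d1 d2] := is_derive1_comp dgh dh.
apply: DeriveDef; first exact: (derivable1P (fun y => g (f y) : R^o) x v).2 d1.
rewrite -d2; exact: (esym (derive_line (fun y => g (f y) : R^o) x v)).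
Qed.

Lemma class_C_comp (V : normedModType R) k (U : set V) (f : V -> R^o)
    (A : set R) (g : R^o -> R^o) : open U -> open A ->
  (forall x, U x -> A (f x)) -> class_C k A g -> class_C k U f ->
  class_C k U (fun x => g (f x) : R^o).
Proof.
move=> oU oA fA.
have cont k' (g' : R^o -> R^o) : class_C k' A g' -> class_C k' U f ->
    {in U, continuous (fun x => g' (f x) : R^o)}.
  move=> Cg Cf x /set_mem Ux.
  apply: continuous_comp; first exact: (class_C_cont Cf Ux).
  exact: (class_C_cont Cg (fA _ Ux)).
elim: k g => [|k IH] g Cg Cf; first by split=> //; exact: cont Cg Cf.
apply: (@class_C_is_derive _ _ _ _ _
  (fun v x => 'D_1 g (f x) * 'D_v f x)) => //; first exact: cont Cg Cf.
- move=> v x Ux; apply: is_derive_real_comp; apply: derivableP.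
    exact: (class_C_derivable Cf Ux).
  exact: (class_C_derivable Cg (fA _ Ux)).
- move=> v; apply: class_CM => //; last exact: class_C_derive.
  by apply: (IH (fun y => 'D_1 g y)); [exact: class_C_derive|exact: class_CW].
Qed.

Lemma class_C_real k (A : set R) (g g' : R^o -> R^o) : open A ->
  (forall x, A x -> is_derive (x : R) 1 (g : R -> R) (g' x)) ->
  class_C k A g' -> class_C k.+1 A g.
Proof.
move=> oA dg Cg'.
apply: (@class_C_is_derive _ _ _ _ _ (fun v x => g' x * v : R^o)) => //.
- move=> x /set_mem Ax; have [d _] := dg _ Ax.
  exact/differentiable_continuous/derivable1_diffP.
- move=> v x Ax; apply: (@is_derive_real_comp _ id); exact: dg.
- by move=> v; apply: class_CM => //; exact: class_C_cst.
Qed.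

Lemma class_C_expR k (A : set R) : open A -> class_C k A (expR : R^o -> R^o).
Proof.
move=> oA; elim: k => [|k IH].
  by split=> // x _; exact: continuous_expR.
by apply: class_C_real IH.
Qed.

Lemma class_C_inv k : class_C k [set x : R | 0 < x] (@GRing.inv R : R^o -> R^o).
Proof.
have o0 : open [set x : R | 0 < x] by exact: open_gt.
elim: k => [|k IH].
  by split=> // x; rewrite inE /= => x0; apply: inv_continuous; rewrite gt_eqF.
apply: (@class_C_real _ _ _ (fun x => - (x^-1 * x^-1))) => //.
  move=> x /= x0; apply: (@is_derive_eq _ _ _ _ _ _ _ (- x ^- 2 *: (1 : R))).
    by apply: (@is_deriveV _ id); rewrite gt_eqF.
  by rewrite scaler1 -exprVn expr2.
by apply: class_CN => //; apply: class_CM.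
Qed.

Lemma class_C_ln k : class_C k [set x : R | 0 < x] (@ln R : R^o -> R^o).
Proof.
have o0 : open [set x : R | 0 < x] by exact: open_gt.
apply: class_CW; apply: class_C_real (class_C_inv _) => //.
Qed.

Lemma class_C_sin_cos k (A : set R) : open A ->
  class_C k A (@sin R : R^o -> R^o) /\ class_C k A (@cos R : R^o -> R^o).
Proof.
move=> oA; elim: k => [|k [IHs IHc]].
  by split; split=> // x _; [exact: continuous_sin|exact: continuous_cos].
split; first by apply: class_C_real IHc.
by apply: (@class_C_real _ _ _ (fun x => - sin x)) => //; exact: class_CN.
Qed.

Lemma class_C_snd (V W : normedModType R) k (O : set V) (U : set W) (f : W -> R^o) :
  class_C k U f -> class_C k (O `*` U) (fun x : V * W => f x.2).
Proof.
have cont k' (g : W -> R^o) : class_C k' U g ->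
    {in O `*` U, continuous (fun x : V * W => g x.2)}.
  move=> Cg x /set_mem [_ Ux]; apply: continuous_comp; first exact: cvg_snd.
  exact: (class_C_cont Cg Ux).
elim: k f => [|k IH] f Cf; split; [exact: cont Cf|by []|exact: cont Cf|].
move=> v; split.
  move=> x /set_mem[_ Ux]; exact: (class_C_derivable Cf Ux).
exact: IH (class_C_derive v.2 Cf).
Qed.

Lemma class_C_fst (V W : normedModType R) k (O : set V) (U : set W) (f : V -> R^o) :
  class_C k O f -> class_C k (O `*` U) (fun x : V * W => f x.1).
Proof.
have cont k' (g : V -> R^o) : class_C k' O g ->
    {in O `*` U, continuous (fun x : V * W => g x.1)}.
  move=> Cg x /set_mem [Ux _]; apply: continuous_comp; first exact: cvg_fst.
  exact: (class_C_cont Cg Ux).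
elim: k f => [|k IH] f Cf; split; [exact: cont Cf|by []|exact: cont Cf|].
move=> v; split.
  move=> x /set_mem[Ux _]; exact: (class_C_derivable Cf Ux).
exact: IH (class_C_derive v.1 Cf).
Qed.

Lemma derive_slicer (V W : normedModType R) (f : V * W -> R^o) t x v :
  (derivable f (t, x) (0, v) -> derivable (fun y => f (t, y)) x v) /\
  'D_v (fun y => f (t, y)) x = 'D_(0, v) f (t, x).
Proof.
rewrite /derivable /derive.
have -> : (fun h : R => h^-1 *: (((fun y => f (t, y)) \o shift x) (h *: v) - f (t, x))) =
    (fun h => h^-1 *: ((f \o shift (t, x)) (h *: ((0, v) : V * W)) - f (t, x))).
  apply/funext => h /=; congr (_ *: (f _ - _)).
  have -> : h *: ((0, v) : V * W) + (t, x) = (h *: 0 + t, h *: v + x) by [].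
  by rewrite scaler0 add0r.
by split.
Qed.

Lemma derive_slicel (V W : normedModType R) (f : V * W -> R^o) t x v :
  (derivable f (t, x) (v, 0) -> derivable (fun y => f (y, x)) t v) /\
  'D_v (fun y => f (y, x)) t = 'D_(v, 0) f (t, x).
Proof.
rewrite /derivable /derive.
have -> : (fun h : R => h^-1 *: (((fun y => f (y, x)) \o shift t) (h *: v) - f (t, x))) =
    (fun h => h^-1 *: ((f \o shift (t, x)) (h *: ((v, 0) : V * W)) - f (t, x))).
  apply/funext => h /=; congr (_ *: (f _ - _)).
  have -> : h *: ((v, 0) : V * W) + (t, x) = (h *: v + t, h *: 0 + x) by [].
  by rewrite scaler0 add0r.
by split.
Qed.

Lemma class_C_slicer (V W : normedModType R) k (O : set V) (U : set W)
    (f : V * W -> R^o) t : O t ->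
  class_C k (O `*` U) f -> class_C k U (fun x => f (t, x)).
Proof.
move=> Ot; have cont k' (g : V * W -> R^o) : class_C k' (O `*` U) g ->
    {in U, continuous (fun x => g (t, x))}.
  move=> Cg x /set_mem Ux.
  apply: (@continuous_comp _ _ _ (fun x => (t, x)) g).
    by apply: cvg_pair; [exact: cvg_cst|exact: cvg_id].
  have TX : (O `*` U) (t, x) by split.
  exact: (class_C_cont Cg TX).
elim: k f => [|k IH] f Cf; split; [exact: cont Cf|by []|exact: cont Cf|].
move=> v; split.
  move=> x /set_mem Ux; have TX : (O `*` U) (t, x) by split.
  exact: (derive_slicer f t x v).1 (class_C_derivable Cf TX).
have -> : (fun x => 'D_v (fun x0 => f (t, x0)) x) = (fun x => 'D_(0, v) f (t, x)).
  by apply/funext => x; exact: (derive_slicer f t x v).2.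
exact: IH (class_C_derive (0, v) Cf).
Qed.

End ClassC.

(** * Derivatives along an interval *)

Section PointwiseDerivative.
Context {R : realType}.
Implicit Types (f g : R -> R) (t a b : R).

Lemma is_derive_add f g t a b : is_derive t 1 f a -> is_derive t 1 g b ->
  is_derive t 1 (fun s => f s + g s) (a + b).
Proof. by move=> *; exact: is_deriveD. Qed.

Lemma is_derive_mul f g t a b : is_derive t 1 f a -> is_derive t 1 g b ->
  is_derive t 1 (fun s => f s * g s) (f t * b + g t * a).
Proof. by move=> *; exact: is_deriveM. Qed.

Lemma is_derive_scal f t a (k : R) : is_derive t 1 f a ->
  is_derive t 1 (fun s => k * f s) (k * a).
Proof. by move=> fa; exact: (is_deriveZ k fa). Qed.

Lemma is_derive_opp f t a : is_derive t 1 f a ->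
  is_derive t 1 (fun s => - f s) (- a).
Proof. by move=> fa; exact: is_deriveN. Qed.

Lemma is_derive_sub f g t a b : is_derive t 1 f a -> is_derive t 1 g b ->
  is_derive t 1 (fun s => f s - g s) (a - b).
Proof. by move=> *; apply: is_derive_add => //; exact: is_derive_opp. Qed.

Lemma is_derive_congr f t a b : is_derive t 1 f a -> a = b -> is_derive t 1 f b.
Proof. by move=> fa <-. Qed.

Lemma is_derive_cos_scal (k t : R) :
  is_derive t 1 (fun s => cos (k * s)) (- (k * sin (k * t))).
Proof.
have H : is_derive t 1 (fun s => k * s) (k * 1).
  by apply: is_derive_scal; exact: is_derive_id.
have H2 := is_derive1_comp (is_derive_cos (k * t)) H.
by apply: is_derive_congr H2 _; ring.
Qed.

Lemma is_derive_sin_scal (k t : R) :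
  is_derive t 1 (fun s => sin (k * s)) (k * cos (k * t)).
Proof.
have H : is_derive t 1 (fun s => k * s) (k * 1).
  by apply: is_derive_scal; exact: is_derive_id.
have H2 := is_derive1_comp (is_derive_sin (k * t)) H.
by apply: is_derive_congr H2 _; ring.
Qed.

End PointwiseDerivative.

Section IntervalDerivative.
Context {R : realType}.

(** A proper interval has no isolated point. This makes the limits in [ddt] unique, end points
    included. *)
Lemma proper_interval_dnbhs (I : set R) t : proper_interval I -> I t ->
  ProperFilter (within (I `\ t) (nbhs t)).
Proof.
move=> [intI [a [b [Ia Ib ab]]]] It.
have [c Ic ct] : exists2 c, I c & c != t.
  have [at_|] := eqVneq a t; last by exists a.
  by exists b => //; rewrite -at_ gt_eqF.
apply: Build_ProperFilter_ex => P /nbhs_ballP[e /= e0 eP].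
(* The point at fraction [d] of the way from [t] to [c] stays between them because [d <= 1], and
   within [e] of [t] because of the second bound. *)
pose d := Num.min 1 (e / 2 / `|c - t|).
have ct0 : 0 < `|c - t| by rewrite normr_gt0 subr_eq0.
have d0 : 0 < d by rewrite lt_min ltr01/= divr_gt0// divr_gt0.
have d1 : d <= 1 by rewrite ge_min lexx.
exists (t + d * (c - t)); apply: eP => /=.
  rewrite /ball /= opprD addNKr normrN normrM (gtr0_norm d0).
  apply: (@le_lt_trans _ _ (e / 2)); last by lra.
  by rewrite -ler_pdivlMr// ge_min lexx orbT.
split; last first.
  move=> /eqP; rewrite /= -subr_eq0 addrAC subrr add0r mulf_eq0 subr_eq0.
  by rewrite (negPf ct) orbF gt_eqF.
have [tc|tc|tc] := ltgtP t c; last by rewrite tc eqxx in ct.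
- by apply: (intI t c) => //; apply/andP; split; nra.
- by apply: (intI c t) => //; apply/andP; split; nra.
Qed.

(** Passes from the two-sided derivative of an extension [g] to the possibly one-sided limit in
    [ddt]. *)
Lemma interval_derive_lim (I : set R) t (f g : R -> R) d :
  proper_interval I -> I t -> (forall s, I s -> f s = g s) ->
  is_derive t 1 g d ->
  (s - t)^-1 * (f s - f t) @[s --> within (I `\ t) (nbhs t)] --> d.
Proof.
move=> pI It fg [/= dg gE]; move: dg; rewrite /derivable => dg.
have {dg} : h^-1 *: ((g \o shift t) (h *: 1) - g t) @[h --> 0^'] --> d.
  by rewrite -gE /derive.
move=> /cvgrPdist_lt H; apply/cvgrPdist_lt => e e0.
have /= := H e e0; rewrite !near_withinE => /nbhs_ballP[r /= r0 rH].
apply/nbhs_ballP; exists r => //= s tsr [Is /eqP st].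
have := rH (s - t); rewrite /ball /= sub0r normrN => /(_ _)/= H1.
rewrite !fg//.
have {}H1 := H1 _ _; rewrite /GRing.scale /= mulr1 subrK in H1.
apply: H1; first by rewrite distrC.
by rewrite subr_eq0.
Qed.

(** Lets an identity known only on [I] be differentiated at every point of [I], an end point
    included. *)
Lemma interval_derive_unique (I : set R) t (f g : R -> R) d e :
  proper_interval I -> I t -> (forall s, I s -> f s = g s) ->
  is_derive t 1 f d -> is_derive t 1 g e -> d = e.
Proof.
move=> pI It fg df dg.
have PF := proper_interval_dnbhs pI It.
have H1 := interval_derive_lim pI It (fun _ _ => erefl) df.
have H2 := interval_derive_lim pI It fg dg.
exact: (cvg_unique _ H1 H2).
Qed.

Lemma interval_derive0_cst (I : set R) (f : R -> R) a b :
  is_interval I -> I a -> I b ->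
  (forall t, I t -> is_derive t 1 f 0) -> f a = f b.
Proof.
move=> intI; wlog ab : a b / a <= b.
  move=> H Ia Ib df; have [ab|ba] := leP a b; first exact: H.
  by rewrite (H b a) //; exact: ltW.
move=> Ia Ib df.
have Iab x : x \in `[a, b] -> I x by rewrite in_itv /=; exact: intI.
have [x||c _] := @MVT_segment R f (fun=> 0) a b ab.
- by move=> /subset_itv_oo_cc/Iab; exact: df.
- apply: derivable_within_continuous => x /Iab Ix; by have [] := df x Ix.
- by rewrite mul0r => /subr0_eq.
Qed.

End IntervalDerivative.

(** * Families smooth jointly in time and space *)

Section SmoothFamilies.
Context {R : realType} {n : nat} (X : closed_kahler R n).
Implicit Types (f g : X -> R) (w : R -> X -> R).

Lemma smooth_fun_continuous f : smooth_fun f -> continuous f.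
Proof.
move=> sf p; have [c Xc cp] := atlas_cover p.
have [oD oC mapC invC mapK] := atlas_chart Xc.
have fE : \forall q \near p, (f \o cinv c) (cmap c q) = f q.
  near=> q; rewrite /= mapK// inE; near: q; exact: open_nbhs_nbhs.
rewrite /continuous_at -(nbhs_singleton fE).
apply: cvg_trans (near_eq_cvg fE) _.
apply: (@continuous_comp _ _ _ (cmap c) (f \o cinv c)).
  exact: (mapC _ (mem_set cp)).
have cc : ccod c (cmap c p) by exists p.
exact: (class_C_cont (sf c Xc 0%N) cc).
Unshelve. all: by end_near. Qed.

Definition smooth_in (O : set R) w := forall c, atlas X c ->
  smooth_on (O `*` ccod c)
    (fun tx : R^o * 'rV[R]_(n + n) => w tx.1 (cinv c tx.2) : R^o).

Lemma smooth_in_fun (O : set R) w t : O t -> smooth_in O w -> smooth_fun (w t).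
Proof.
by move=> Ot sw c Xc k; exact: (class_C_slicer Ot (sw c Xc k)).
Qed.

Lemma smooth_in_derivable (O : set R) w t p : O t -> smooth_in O w ->
  derivable (fun s => w s p) t 1.
Proof.
move=> Ot sw; have [c Xc cp] := atlas_cover p.
have [oD oC mapC invC mapK] := atlas_chart Xc.
have OC : (O `*` ccod c) (t, cmap c p) by split=> //; exists p.
have := (derive_slicel (fun tx : R^o * 'rV[R]_(n + n) => w tx.1 (cinv c tx.2) : R^o)
  t (cmap c p) 1).1 (class_C_derivable (sw c Xc 1%N) OC).
by rewrite /= mapK ?inE.
Qed.

Lemma smooth_in_derive (O : set R) w : smooth_in O w ->
  smooth_in O (fun t p => 'D_1 (fun s => w s p) t).
Proof.
move=> sw c Xc k.
have -> : (fun tx : R^o * 'rV[R]_(n + n) => 'D_1 (fun s : R => w s (cinv c tx.2)) tx.1 : R^o)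
  = (fun tx => 'D_(1, 0) (fun tx : R^o * 'rV[R]_(n + n) => w tx.1 (cinv c tx.2) : R^o) tx).
  apply/funext => -[t x].
  exact: (derive_slicel (fun tx : R^o * 'rV[R]_(n + n) => w tx.1 (cinv c tx.2) : R^o) t x 1).2.
have := @class_C_derive _ _ _ k _ _ (1 : R^o, 0 : 'rV[R]_(n + n)) (sw c Xc k.+1).
exact.
Qed.

Lemma smooth_in_is_derive (O : set R) w t p : O t -> smooth_in O w ->
  is_derive t 1 (fun s => w s p) ('D_1 (fun s => w s p) t).
Proof. by move=> Ot sw; apply: derivableP; exact: smooth_in_derivable sw. Qed.

Lemma smooth_in_continuous (O : set R) w t p : O t -> smooth_in O w ->
  {for (t, p), continuous (fun tp : R * X => w tp.1 tp.2)}.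
Proof.
move=> Ot sw; have [c Xc cp] := atlas_cover p.
have [oD oC mapC invC mapK] := atlas_chart Xc.
pose F := (fun tx : R^o * 'rV[R]_(n + n) => w tx.1 (cinv c tx.2) : R^o).
pose m (tp : R * X) := (tp.1 : R^o, cmap c tp.2).
have fE : \forall q \near (t, p), (F \o m) q = w q.1 q.2.
  exists (setT, cdom c); first by split=> /=; [exact: filterT|exact: open_nbhs_nbhs].
  by move=> [s q] [_ /= cq]; rewrite /F/m/= mapK ?inE.
suff H : (F \o m) @ (t, p) --> (F \o m) (t, p).
  have e : (F \o m) (t, p) = w t p := nbhs_singleton fE.
  change (w tp.1 tp.2 @[tp --> (t, p)] --> w t p); rewrite -e.
  exact: cvg_trans (near_eq_cvg fE) H.
apply: (@continuous_comp _ _ _ m F).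
  have H1 : (fun tp : R * X => tp.1 : R^o) @ (t, p) --> (t : R^o) by exact: cvg_fst.
  have H2 : (fun tp : R * X => cmap c tp.2) @ (t, p) --> cmap c p.
    have H0 : {for (t, p), continuous (snd : R * X -> X)} by exact: cvg_snd.
    by have := continuous_comp H0 (mapC _ (mem_set cp)).
  exact: (cvg_pair H1 H2).
have OC : (O `*` ccod c) (t, cmap c p) by split=> //; exists p.
exact: (class_C_cont (sw c Xc 0%N) OC).
Qed.

(** Joint continuity gives a bound near each [(t, p)]; compactness makes the time neighbourhood
    independent of [p]. The uniform bound is needed to differentiate under the integral. *)
Lemma smooth_in_bounded (O : set R) w t : open O -> O t -> smooth_in O w ->
  exists M, \forall s \near t, O s /\ forall p, `|w s p| <= M.
Proof.
move=> oO Ot sw.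
have [M0 HM] := continuous_bounded (smooth_fun_continuous (smooth_in_fun Ot sw)).
exists (M0 + 1).
have /compact_near_coveringP := @carrier_compact _ _ X.
move=> /(_ R (nbhs t) (fun s p => `|w s p| <= M0 + 1) _)[].
  move=> p _.
  have /cvgrPdist_lt/(_ 1 ltr01) := @smooth_in_continuous O w t p Ot sw.
  case=> -[A B] /= [At Bp] AB; exists (B, A) => //= -[q s] /= [Bq As].
  have /= := AB (s, q) (conj As Bq); have := HM p.
  by move: (w t p) (w s q) => a b; rewrite !ler_norml !ltr_norml; lra.
move=> e /= e0 eH; near=> s; split; first by near: s; exact: open_nbhs_nbhs.
by move=> p; apply: (eH s) => //; near: s; exact: nbhsx_ballx.
Unshelve. all: by end_near. Qed.

End SmoothFamilies.

(** * Taylor expansions *)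

Section PowerSeries.
Context {R : realType}.

(** Covers both orders of [s] and [t]. The clause [c != t] is there so that a power of [c - t] can
    be cancelled in the Taylor estimate. *)
Lemma MVT_ball_strict (f df : R -> R) (t r s : R) : s != t ->
  (forall x : R, ball t r x -> is_derive x 1 f (df x)) -> ball t r s ->
  exists c, [/\ c != t, ball t r c & f s - f t = df c * (s - t)].
Proof.
move=> st_neq dfE; rewrite /ball /= ltr_norml => /andP[ts1 ts2].
have [st|st|/eqP] := ltgtP s t; last by rewrite (negPf st_neq).
- have bx x : x \in `[s, t] -> ball t r x.
    by rewrite in_itv /= /ball /= ltr_norml => /andP[sx xt]; lra.
  have [x||c cst fE] := @MVT R f df s t st.
  + by move=> /subset_itv_oo_cc/bx; exact: dfE.
  + by apply: derivable_within_continuous => x /bx tx; have [] := dfE x tx.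
  + exists c; split; first by move: cst; rewrite in_itv/= => /andP[_ /lt_eqF->].
      by apply: bx; exact: subset_itv_oo_cc.
    by rewrite -[RHS]opprK -mulrN opprB -fE opprB.
- have bx x : x \in `[t, s] -> ball t r x.
    by rewrite in_itv /= /ball /= ltr_norml => /andP[sx xt]; lra.
  have [x||c cst fE] := @MVT R f df t s st.
  + by move=> /subset_itv_oo_cc/bx; exact: dfE.
  + by apply: derivable_within_continuous => x /bx tx; have [] := dfE x tx.
  + exists c; split=> //; first by move: cst; rewrite in_itv/= => /andP[/gt_eqF->].
    by apply: bx; exact: subset_itv_oo_cc.
Qed.

Lemma is_derive_expn (t c : R) n :
  is_derive t 1 (fun s => (s - c) ^+ n.+1) (n.+1%:R * (t - c) ^+ n).
Proof.
have d : is_derive t 1 (fun s : R => s - c) 1.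
  by apply: (is_derive_congr (is_derive_sub (is_derive_id t 1) (is_derive_cst c t 1)));
    rewrite subr0.
elim: n => [|n IH]; first by rewrite expr0 mulr1.
have -> : (fun s => (s - c) ^+ n.+2) = (fun s => (s - c) * (s - c) ^+ n.+1).
  by apply/funext => s; rewrite exprS.
apply: (is_derive_congr (is_derive_mul d IH)).
by rewrite mulr1 mulrCA -exprS -[n.+2%:R]natr1; ring.
Qed.

(* The step from [n] to [n.+1] is Cauchy's mean value theorem, comparing the
   remainder with [(x - t) ^+ n.+1]. *)
Lemma taylor_remainder (F : nat -> R -> R) (t r K : R) n :
  (forall k (x : R), (k < n)%N -> ball t r x -> is_derive x 1 (F k) (F k.+1 x)) ->
  (forall x : R, ball t r x -> `|F n x| <= K) ->
  forall x : R, ball t r x ->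
  `|F 0%N x - \sum_(k < n) F k t / k`!%:R * (x - t) ^+ k| <= K / n`!%:R * `|x - t| ^+ n.
Proof.
elim: n F => [|n IH] F dF FK x tx.
  by rewrite big_ord0 subr0 fact0 divr1 expr0 mulr1; exact: FK.
have [->|xt] := eqVneq x t.
  rewrite big_ord_recl /= !expr0 fact0 divr1 mulr1 big1 => [|i _].
    by rewrite addr0 !subrr !normr0 expr0n mulr0.
  by rewrite subrr exprS mul0r mulr0.
pose S s := \sum_(k < n) F k.+1 t / k.+1`!%:R * (s - t) ^+ k.+1.
pose dS s := \sum_(k < n) F k.+1 t / k`!%:R * (s - t) ^+ k.
have dSE (s : R) : is_derive s 1 S (dS s).
  rewrite /S; have -> : (fun s => \sum_(k < n) F k.+1 t / k.+1`!%:R * (s - t) ^+ k.+1) =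
      \sum_(k < n) (fun s => F k.+1 t / k.+1`!%:R * (s - t) ^+ k.+1).
    by apply/funext => y; rewrite fct_sumE.
  apply: is_derive_sum => k.
  apply: (is_derive_congr (is_derive_scal _ (is_derive_expn s t k))).
  rewrite mulrA factS natrM invfM; congr (_ * _).
  have k0 : k.+1%:R != 0 :> R by [].
  by rewrite mulrA mulrAC mulfVK.
pose G s := F 0%N s - F 0%N t - S s.
have GE : F 0%N x - \sum_(k < n.+1) F k t / k`!%:R * (x - t) ^+ k = G x.
  rewrite big_ord_recl /= fact0 divr1 expr0 mulr1 opprD addrA; congr (_ - _).
have G0 : G t = 0.
  rewrite /G subrr sub0r /S big1 ?oppr0// => k _.
  by rewrite subrr exprS mul0r mulr0.
have dG (s : R) : ball t r s -> is_derive s 1 G (F 1%N s - dS s).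
  move=> ts.
  apply: (is_derive_congr (is_derive_sub (is_derive_sub (dF 0%N s isT ts)
    (is_derive_cst (F 0%N t) s 1)) (dSE s))).
  by rewrite subr0.
have bnd (s : R) : ball t r s -> `|F 1%N s - dS s| <= K / n`!%:R * `|s - t| ^+ n.
  by move=> ts; apply: (IH (fun k => F k.+1)) => // k y kn; exact: dF.
rewrite GE.
(* [phi] vanishes at both [t] and [x], so its derivative vanishes at some [c] different from [t];
   this bounds [G x] through the remainder of [F 1] at [c]. *)
pose phi s := (x - t) ^+ n.+1 * G s - G x * (s - t) ^+ n.+1.
have [s ts|c [ct tc]] := @MVT_ball_strict phi
   (fun s => (x - t) ^+ n.+1 * (F 1%N s - dS s) - G x * (n.+1%:R * (s - t) ^+ n)) t r x xt _ tx.
  apply: is_derive_sub; first by apply: is_derive_scal; exact: dG.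
  by apply: is_derive_scal; exact: is_derive_expn.
have -> : phi x - phi t = 0.
  by rewrite /phi G0 subrr expr0n /=; ring.
move=> /esym/eqP; rewrite mulf_eq0 [x - t == 0]subr_eq0 (negPf xt) orbF.
rewrite subr_eq0 => /eqP E.
have ct0 : 0 < `|c - t| ^+ n by rewrite exprn_gt0// normr_gt0 subr_eq0.
have n0 : 0 < n.+1%:R :> R by [].
have : `|G x| * (n.+1%:R * `|c - t| ^+ n) <= `|x - t| ^+ n.+1 * (K / n`!%:R * `|c - t| ^+ n).
  have -> : `|G x| * (n.+1%:R * `|c - t| ^+ n) = `|G x * (n.+1%:R * (c - t) ^+ n)|.
    by rewrite !normrM normrX (ger0_norm (ltW n0)).
  rewrite -E normrM normrX ler_wpM2l ?exprn_ge0//; exact: bnd.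
have -> : `|x - t| ^+ n.+1 * (K / n`!%:R * `|c - t| ^+ n) =
   (K / n.+1`!%:R * `|x - t| ^+ n.+1) * (n.+1%:R * `|c - t| ^+ n).
  have f0 : n`!%:R != 0 :> R by rewrite pnatr_eq0 -lt0n fact_gt0.
  rewrite factS natrM; move: (lt0r_neq0 n0) f0; move: n.+1%:R n`!%:R => a b a0 b0.
  by field; rewrite a0 b0.
by rewrite ler_pM2r// mulr_gt0.
Qed.

(** The factorial in the bound cancels the one in the Taylor remainder, which leaves a geometric
    sequence of ratio [M * |t - t0| < 1]. Remainders of order at least one suffice, so [F 0] itself,
    later a logarithm, needs no bound. *)
Lemma taylor_cvg (F : nat -> R -> R) (t0 r C M : R) : 0 < r -> 0 < M ->
  (forall k (x : R), ball t0 r x -> is_derive x 1 (F k) (F k.+1 x)) ->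
  (forall k (x : R), ball t0 r x -> `|F k.+1 x| <= C * M ^+ k.+1 * k.+1`!%:R) ->
  \forall t \near t0,
    series (fun k => F k t0 / k`!%:R * (t - t0) ^+ k) @ \oo --> F 0%N t.
Proof.
move=> r0 M0 dF FB.
apply/nbhs_ballP; exists (Num.min r (M^-1)) => /=.
  by rewrite lt_min r0 invr_gt0.
move=> t; rewrite /ball /= lt_min => /andP[tr tM].
have tb : ball t0 r t by [].
pose q := M * `|t - t0|.
have q1 : `|q| < 1.
  rewrite ger0_norm ?mulr_ge0// ?(ltW M0)//.
  by rewrite -(mulfV (lt0r_neq0 M0)) ltr_pM2l// distrC.
have key n : `|F 0%N t - series (fun k => F k t0 / k`!%:R * (t - t0) ^+ k) n.+1|
    <= `|C| * q ^+ n.+1.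
  rewrite /series /= big_mkord.
  apply: (le_trans (taylor_remainder (fun k x _ => dF k x) (FB n) tb)).
  rewrite mulfK ?pnatr_eq0 -?lt0n ?fact_gt0// -mulrA -exprMn.
  by rewrite ler_wpM2r ?ler_norm// exprn_ge0// mulr_ge0// ltW.
have /cvgrPdist_lt cq := @cvg_geometric R `|C| q q1.
apply/cvgrPdist_lt => e e0; have := cq e e0.
case=> N _ NH; exists N.+1 => //= n /= Nn.
case: n Nn => // n Nn; apply: (le_lt_trans (key n)).
have := NH n.+1 (ltnW Nn); rewrite /geometric /= sub0r normrN.
exact: le_lt_trans (ler_norm _).
Qed.

End PowerSeries.

(** * Differentiation under the integral sign *)

Section DerivativeUnderIntegral.
Context {R : realType}.

Context {n : nat} (X : closed_kahler R n).
Variable mu : {measure set (borel X) -> \bar R}.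
Hypothesis hmu : is_kahler_volume mu.

Lemma Rint_norm_le (f : X -> R) (B : R) : continuous f ->
  (forall p, `|f p| <= B) -> `|\int[mu]_p f p| <= B * Vol mu.
Proof.
move=> cf fB; rewrite ler_norml -mulNr -!(Rint_cst mu).
have cc (a : R) : continuous (fun _ : X => a) by move=> p; exact: cvg_cst.
by apply/andP; split; apply: (Rint_le hmu) => // p;
  have := fB p; rewrite ler_norml => /andP[].
Qed.

(** Second-order Taylor with a bound on the second time derivative uniform in [p] shows that the
    difference quotient of the integral misses its limit by at most a constant times [|h|]. *)
Lemma is_derive_Rint (O : set R) (w : R -> X -> R) (g : X -> R) t :
  open O -> O t -> smooth_in O w -> continuous g ->
  is_derive t 1 (fun s => \int[mu]_p (w s p * g p))
    (\int[mu]_p ('D_1 (fun s => w s p) t * g p)).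
Proof.
move=> oO Ot sw cg.
have sw1 := smooth_in_derive sw; have sw2 := smooth_in_derive sw1.
have [M0 HM] := smooth_in_bounded oO Ot sw2.
have [G0 HG] := continuous_bounded cg.
have cw s : O s -> continuous (w s).
  by move=> Os; exact: smooth_fun_continuous (smooth_in_fun Os sw).
have cw1 s : O s -> continuous (fun p => 'D_1 (fun s => w s p) s).
  by move=> Os; exact: smooth_fun_continuous (smooth_in_fun Os sw1).
pose M := `|M0| + 1; pose G := `|G0| + 1.
have M0_ : 0 < M by rewrite ltr_pwDr.
have G0_ : 0 < G by rewrite ltr_pwDr.
have V0 := Vol_gt0 hmu.
set L := \int[mu]_p ('D_1 (fun s => w s p) t * g p).
set F := fun s => \int[mu]_p (w s p * g p).
have [r /= r0 rH] : nbhs_ball t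
    [set s | O s /\ forall p, `|'D_1 (fun s0 => 'D_1 (fun s1 => w s1 p) s0) s| <= M].
  apply/nbhs_ballP; apply: filterS HM => s [Os Hs]; split=> // p.
  by apply: le_trans (Hs p) _; rewrite /M (le_trans (ler_norm _))// lerDl.
have key h : 0 < `|h| < r ->
    `|h^-1 * (F (h + t) - F t) - L| <= `|h| * (M * G * Vol mu).
  move=> /andP[h0 hr].
  have th : ball t r (h + t) by rewrite /ball /= opprD addrCA subrr addr0 normrN.
  have [Oh _] := rH _ th.
  pose e p := w (h + t) p - w t p - h * 'D_1 (fun s => w s p) t.
  have eB p : `|e p * g p| <= M * `|h| ^+ 2 * G.
    rewrite normrM ler_pM//; last first.
      by rewrite (le_trans (HG p))// /G (le_trans (ler_norm _))// lerDl.
    pose T k s : R := match k with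
      | 0%N => w s p
      | 1%N => 'D_1 (fun s1 => w s1 p) s
      | _ => 'D_1 (fun s0 => 'D_1 (fun s1 => w s1 p) s0) s end.
    have dT k (x : R) : (k < 2)%N -> ball t r x -> is_derive x 1 (T k) (T k.+1 x).
      case: k => [|[|//]] _ /rH[Ox _]; first exact: (smooth_in_is_derive p Ox sw).
      exact: (smooth_in_is_derive p Ox sw1).
    have TB (x : R) : ball t r x -> `|T 2 x| <= M by move=> /rH[_]; exact.
    have := taylor_remainder dT TB th.
    rewrite 2!big_ord_recl big_ord0 /= addrK !fact0 expr0 mulr1 !divr1 expr1 addr0.
    rewrite opprD addrA [_ * h]mulrC => H; apply: (le_trans H).
    by rewrite ler_wpM2r ?exprn_ge0// ler_pdivrMr// ler_peMr ?ler1n// ltW.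
  have ce : continuous (fun p => e p * g p).
    apply: contM => //.
    have -> : e = (fun p => (w (h + t) p + (-1) * w t p) + (- h) * 'D_1 (fun s => w s p) t).
      by apply/funext => p; rewrite /e mulN1r mulNr.
    apply: contD; first by apply: contD; [exact: cw|apply: contZ; exact: cw].
    by apply: contZ; exact: cw1.
  have -> : h^-1 * (F (h + t) - F t) - L = h^-1 * \int[mu]_p (e p * g p).
    have hn0 : h != 0 by rewrite -normr_gt0.
    have -> : \int[mu]_p (e p * g p) = F (h + t) - F t - h * L.
      have c1 := contM (cw _ Oh) cg; have c2 := contM (cw _ Ot) cg.
      have c3 := contM (cw1 _ Ot) cg.
      transitivity (1 * (\int[mu]_p (1 * (w (h + t) p * g p) + (-1) * (w t p * g p)))
        + (- h) * L).
        rewrite -(Rint_lin hmu)//; last by apply: contD; exact: contZ.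
        by apply: eq_Rintegral => p _; rewrite /e; ring.
      by rewrite (Rint_lin hmu)// /F; ring.
    by rewrite [RHS]mulrBr mulrA mulVf// mul1r.
  rewrite normrM normfV ler_pdivrMl//.
  apply: le_trans (Rint_norm_le ce eB) _.
  by rewrite le_eqVlt; apply/orP; left; apply/eqP; ring.
have H : h^-1 *: ((F \o shift t) (h *: 1) - F t) @[h --> 0^'] --> L.
  apply/cvgrPdist_le => e e0; rewrite near_withinE.
  pose K := M * G * Vol mu.
  have K0 : 0 < K by rewrite !mulr_gt0.
  apply/nbhs_ballP; exists (Num.min r (e / K)) => /=.
    by rewrite lt_min r0/= divr_gt0.
  move=> h; rewrite /ball /= sub0r normrN lt_min => /andP[hr he] hn0.
  have := key h; rewrite normr_gt0 hn0 hr => /(_ isT) H.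
  rewrite distrC /= /GRing.scale /= mulr1; apply: le_trans H _.
  by rewrite -ler_pdivlMr// ltW.
apply: DeriveDef; first exact: cvgP H.
exact: cvg_lim H.
Qed.

End DerivativeUnderIntegral.

(** * Geodesics are great circles *)

Section Oscillator.
Context {R : realType} (J : set R) (k : R -> R).
Hypothesis Jint : is_interval J.
Hypothesis J0 : J 0.

Definition oscillates (y dy : R -> R) := forall t, J t ->
  is_derive t 1 y (dy t) /\ is_derive t 1 dy (- k t * y t).

Lemma oscillates_lin (a b : R) y1 dy1 y2 dy2 :
  oscillates y1 dy1 -> oscillates y2 dy2 ->
  oscillates (fun t => a * y1 t + b * y2 t) (fun t => a * dy1 t + b * dy2 t).
Proof.
move=> o1 o2 t Jt; have [d1 d1'] := o1 t Jt; have [d2 d2'] := o2 t Jt; split.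
  by apply: is_derive_add; exact: is_derive_scal.
apply: (is_derive_congr (is_derive_add (is_derive_scal a d1') (is_derive_scal b d2'))).
by ring.
Qed.

Lemma wronskian_cst y1 dy1 y2 dy2 s t :
  oscillates y1 dy1 -> oscillates y2 dy2 -> J s -> J t ->
  y1 s * dy2 s - dy1 s * y2 s = y1 t * dy2 t - dy1 t * y2 t.
Proof.
move=> o1 o2 Js Jt.
apply: (@interval_derive0_cst _ J (fun t => y1 t * dy2 t - dy1 t * y2 t)) => // r Jr.
have [d1 d1'] := o1 r Jr; have [d2 d2'] := o2 r Jr.
apply: (is_derive_congr (is_derive_sub (is_derive_mul d1 d2') (is_derive_mul d1' d2))).
by ring.
Qed.

(** Replaces a Lipschitz uniqueness theorem, since [k] is an arbitrary function. The Wronskians of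
    [y] with [p] and [q] vanish, and [y] times the Wronskian of [p] and [q] is a combination of
    these two. *)
Lemma oscillates_unique y dy p dp q dq :
  oscillates y dy -> oscillates p dp -> oscillates q dq ->
  p 0 * dq 0 - dp 0 * q 0 != 0 -> y 0 = 0 -> dy 0 = 0 ->
  forall t, J t -> y t = 0.
Proof.
move=> oy op oq D0 y0 dy0 t Jt.
have W1 := wronskian_cst oy op J0 Jt; have W2 := wronskian_cst oy oq J0 Jt.
have W3 := wronskian_cst op oq J0 Jt.
rewrite y0 dy0 !mul0r subrr in W1 W2; rewrite W3 in D0.
apply/eqP; rewrite -(mulIr_eq0 _ (mulIf D0)); apply/eqP.
have -> : y t * (p t * dq t - dp t * q t) =
   p t * (y t * dq t - dy t * q t) - q t * (y t * dp t - dy t * p t) by ring.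
by rewrite -W1 -W2 !mulr0 subrr.
Qed.

(** Rotating [(a, beta b)] back by the angle [beta t] gives the two constants [E1] and [E2];
    inverting the rotation recovers [a] and [b]. *)
Lemma harmonic_solution (beta : R) (a b : R -> R) : beta != 0 ->
  a 0 = 1 -> b 0 = 0 ->
  (forall t, J t -> is_derive t 1 a (- beta ^+ 2 * b t)) ->
  (forall t, J t -> is_derive t 1 b (a t)) ->
  forall t, J t -> a t = cos (beta * t) /\ b t = sin (beta * t) / beta.
Proof.
move=> beta0 a0 b0 da db t Jt.
pose c := fun s => cos (beta * s); pose s := fun s => beta^-1 * sin (beta * s).
have dc (x : R) : is_derive x 1 c (- beta ^+ 2 * s x).
  by apply: (is_derive_congr (is_derive_cos_scal beta x)); rewrite /s; field.
have ds (x : R) : is_derive x 1 s (c x).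
  apply: (is_derive_congr (is_derive_scal beta^-1 (is_derive_sin_scal beta x))).
  by rewrite /c; field.
have E1 : a t * c t + beta ^+ 2 * (b t * s t) = 1.
  have -> : 1 = a 0 * c 0 + beta ^+ 2 * (b 0 * s 0).
    by rewrite a0 b0 /c mulr0 cos0; ring.
  apply: (@interval_derive0_cst _ J (fun t => a t * c t + beta ^+ 2 * (b t * s t))) => // x Jx.
  apply: (is_derive_congr (is_derive_add (is_derive_mul (da x Jx) (dc x))
    (is_derive_scal (beta ^+ 2) (is_derive_mul (db x Jx) (ds x))))).
  by ring.
have E2 : b t * c t - a t * s t = 0.
  have -> : 0 = b 0 * c 0 - a 0 * s 0.
    by rewrite a0 b0 /s mulr0 sin0; ring.
  apply: (@interval_derive0_cst _ J (fun t => b t * c t - a t * s t)) => // x Jx.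
  apply: (is_derive_congr (is_derive_sub (is_derive_mul (db x Jx) (dc x))
    (is_derive_mul (da x Jx) (ds x)))).
  by ring.
have E3 : c t ^+ 2 + beta ^+ 2 * s t ^+ 2 = 1.
  rewrite -(cos2Dsin2 (beta * t)) /c /s; field => //.
have E4 : s t = sin (beta * t) / beta by rewrite /s mulrC.
split; last rewrite -E4.
  have -> : cos (beta * t) = c t by [].
  have -> : a t = a t * (c t ^+ 2 + beta ^+ 2 * s t ^+ 2) by rewrite E3 mulr1.
  have -> : a t * (c t ^+ 2 + beta ^+ 2 * s t ^+ 2) =
    c t * (a t * c t + beta ^+ 2 * (b t * s t)) -
      beta ^+ 2 * s t * (b t * c t - a t * s t) by ring.
  by rewrite E1 E2; ring.
have -> : b t = b t * (c t ^+ 2 + beta ^+ 2 * s t ^+ 2) by rewrite E3 mulr1.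
have -> : b t * (c t ^+ 2 + beta ^+ 2 * s t ^+ 2) =
    s t * (a t * c t + beta ^+ 2 * (b t * s t)) +
      c t * (b t * c t - a t * s t) by ring.
by rewrite E1 E2; ring.
Qed.

End Oscillator.

Section SphereGeodesic.
Context {R : realType} {n : nat} (X : closed_kahler R n).
Variable mu : {measure set (borel X) -> \bar R}.
Hypothesis hmu : is_kahler_volume mu.

Lemma Rint_prod_lin (f g : X -> R) (a b c d : R) : continuous f -> continuous g ->
  \int[mu]_p ((a * f p + b * g p) * (c * f p + d * g p)) =
  a * c * (\int[mu]_p (f p * f p)) + (a * d + b * c) * (\int[mu]_p (f p * g p)) +
  b * d * (\int[mu]_p (g p * g p)).
Proof.
move=> cf cg; have cff := contM cf cf; have cfg := contM cf cg; have cgg := contM cg cg.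
transitivity (\int[mu]_p (1 * (a * c * (f p * f p) + (a * d + b * c) * (f p * g p))
    + b * d * (g p * g p))).
  by apply: eq_Rintegral => p _; ring.
rewrite (Rint_lin hmu)//; last by apply: contD; exact: contZ.
by rewrite (Rint_lin hmu)// mul1r.
Qed.

Variables (J : set R) (k : R -> R) (psi dpsi : X -> R -> R).
Hypothesis Jint : proper_interval J.
Hypothesis J0 : J 0.
Hypothesis psi_osc : forall p, oscillates J k (psi p) (dpsi p).
Hypothesis psi_gt0 : forall p t, J t -> 0 < psi p t.
Hypothesis psi_cont : continuous (psi^~ 0).
Hypothesis dpsi_cont : continuous (dpsi^~ 0).
Hypothesis psi_sphere : forall t, J t -> \int[mu]_p (psi p t * psi p t) = Vol mu.

Let S := \int[mu]_p (dpsi p 0 * dpsi p 0).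
Let z := \int[mu]_p (psi p 0 * dpsi p 0).
Let beta := Num.sqrt (S / Vol mu).

Let intJ : is_interval J. Proof. by case: Jint. Qed.

Let V0 : 0 < Vol mu. Proof. exact: Vol_gt0. Qed.

(** Here the velocity is proportional to the position. All [psi p] are then scaled by one common
    factor [h]; the sphere constraint gives [h ^ 2 = 1] and positivity gives [h = 1]. *)
Let degenerate_case :
  (forall p q, psi p 0 * dpsi q 0 - dpsi p 0 * psi q 0 = 0) ->
  (forall p t, J t -> psi p t = psi p 0) /\ (forall p, dpsi p 0 = 0).
Proof.
move=> W0; pose q : X := point.
have psiE p t : J t -> psi p t = psi p 0 * (psi q t / psi q 0).
  move=> Jt.
  have q0 := psi_gt0 q J0; have qt := psi_gt0 q Jt.
  have : psi p t * (psi q t)^-1 = psi p 0 * (psi q 0)^-1.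
    apply: (@interval_derive0_cst _ J (fun t => psi p t * (psi q t)^-1)) => // s Js.
    have qs := psi_gt0 q Js.
    have [d1 _] := psi_osc p Js; have [d2 _] := psi_osc q Js.
    have qn0 : psi q s != 0 by rewrite gt_eqF.
    apply: (is_derive_congr (is_derive_mul d1 (is_deriveV qn0 d2))).
    have W := wronskian_cst intJ (psi_osc p) (psi_osc q) J0 Js.
    rewrite W0 in W; rewrite /GRing.scale /=.
    have -> : psi p s * (- psi q s ^- 2 * dpsi q s) + (psi q s)^-1 * dpsi p s =
       - (psi p s * dpsi q s - dpsi p s * psi q s) / psi q s ^+ 2.
      by field.
    by rewrite -W oppr0 mul0r.
  move=> H; have qtn : psi q t != 0 by rewrite gt_eqF.
  by rewrite -[LHS](mulfVK qtn) H mulrAC mulrA.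
have psi_cst p t : J t -> psi p t = psi p 0.
  move=> Jt; rewrite psiE//; set h := psi q t / psi q 0.
  have h0 : 0 < h by rewrite divr_gt0 ?psi_gt0.
  have : h * h * Vol mu = Vol mu.
    rewrite -{2}(psi_sphere Jt) -(psi_sphere J0).
    have c := contM psi_cont psi_cont.
    have /esym := Rint_lin hmu (h * h) 0 c c; rewrite mul0r addr0 => ->.
    apply: eq_Rintegral => r _; rewrite (psiE r t Jt) -/h; ring.
  move=> /(canRL (mulfK _)); rewrite divff ?gt_eqF// => /(_ isT) hh.
  have -> : h = 1.
    apply/eqP; rewrite -(@eqrXn2 _ 2) ?ltW//.
    by rewrite expr1n expr2 hh.
  by rewrite mulr1.
split=> // p; have [d _] := psi_osc p J0.
apply: (@interval_derive_unique _ J 0 (psi p) (cst (psi p 0)) _ _ Jint J0 _ d).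
by move=> s Js; rewrite psi_cst.
Qed.

Lemma sphere_geodesic : z = 0 /\ forall p t, J t ->
  psi p t = psi p 0 * cos (beta * t) + dpsi p 0 * (sin (beta * t) / beta).
Proof.
have [W0|] := pselect (forall p q, psi p 0 * dpsi q 0 - dpsi p 0 * psi q 0 = 0).
  have [psi_cst dpsi0] := degenerate_case W0.
  have I0 (f : X -> R) : (forall p, f p = 0) -> \int[mu]_p f p = 0.
    by move=> f0; rewrite -(mul0r (Vol mu)) -Rint_cst; apply: eq_Rintegral => p _.
  split; first by apply: I0 => p; rewrite dpsi0 mulr0.
  have -> : beta = 0.
    by rewrite /beta /S I0 ?mul0r ?sqrtr0// => p; rewrite dpsi0 mulr0.
  by move=> p t Jt; rewrite psi_cst// mul0r cos0 dpsi0 mulr1 mul0r addr0.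
move=> /existsNP[p /existsNP[q /eqP D0]].
set D := psi p 0 * dpsi q 0 - dpsi p 0 * psi q 0 in D0.
(* Cramer's rule: [a] and [b] are the combinations of [psi p] and [psi q] with initial data [(1, 0)]
   and [(0, 1)]. *)
pose a t := dpsi q 0 / D * psi p t + (- dpsi p 0 / D) * psi q t.
pose da t := dpsi q 0 / D * dpsi p t + (- dpsi p 0 / D) * dpsi q t.
pose b t := (- psi q 0 / D) * psi p t + (psi p 0 / D) * psi q t.
pose db t := (- psi q 0 / D) * dpsi p t + (psi p 0 / D) * dpsi q t.
have oa : oscillates J k a da by exact: oscillates_lin.
have ob : oscillates J k b db by exact: oscillates_lin.
have a0 : a 0 = 1 by rewrite /a /D; field; exact: D0.
have da0 : da 0 = 0 by rewrite /da /D; field; exact: D0.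
have b0 : b 0 = 0 by rewrite /b /D; field; exact: D0.
have db0 : db 0 = 1 by rewrite /db /D; field; exact: D0.
have psiE x t : J t -> psi x t = a t * psi x 0 + b t * dpsi x 0.
  move=> Jt.
  have o := oscillates_lin 1 (-1) (psi_osc x) (oscillates_lin (psi x 0) (dpsi x 0) oa ob).
  have := oscillates_unique intJ J0 o (psi_osc p) (psi_osc q) D0 _ _ Jt.
  rewrite a0 b0 da0 db0 !mulr0 !mulr1 addr0 add0r !mul1r !mulN1r !subrr.
  by move=> /(_ erefl erefl) H; apply/subr0_eq; rewrite -[RHS]H; ring.
have sph t : J t -> a t * a t * Vol mu + (a t * b t + b t * a t) * z + b t * b t * S = Vol mu.
  move=> Jt; rewrite -{1}(psi_sphere J0) -Rint_prod_lin// -(psi_sphere Jt).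
  by apply: eq_Rintegral => x _; rewrite (psiE x t Jt).
(* Half the derivative of [sph]. Only the scalar functions [a] and [b] are differentiated, the
   integrals being constants. *)
have sph' t : J t -> a t * da t * Vol mu + (a t * db t + b t * da t) * z + b t * db t * S = 0.
  move=> Jt; have [d1 _] := oa t Jt; have [d2 _] := ob t Jt.
  suff : 2 * (a t * da t * Vol mu + (a t * db t + b t * da t) * z + b t * db t * S) = 0.
    by move/eqP; rewrite mulf_eq0 pnatr_eq0 => /eqP.
  pose f s := Vol mu * (a s * a s) + (2 * z) * (a s * b s) + S * (b s * b s).
  apply: (@interval_derive_unique _ J t f (cst (Vol mu)) _ _ Jint Jt).
  - by move=> s Js; rewrite /= -(sph s Js) /f; ring.
  - apply: (is_derive_congr (is_derive_add (is_derive_add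
      (is_derive_scal (Vol mu) (is_derive_mul d1 d1))
      (is_derive_scal (2 * z) (is_derive_mul d1 d2)))
      (is_derive_scal S (is_derive_mul d2 d2)))).
    by ring.
have z0 : z = 0.
  by have := sph' 0 J0; rewrite a0 b0 da0 db0 !(mulr0, mul0r, mulr1, mul1r, addr0, add0r).
have wr t : J t -> a t * db t - da t * b t = 1.
  move=> Jt; rewrite -(wronskian_cst intJ oa ob J0 Jt) a0 b0 da0 db0; ring.
(* [sph'] and [wr] are two linear equations in [da t] and [db t], whose determinant equals [Vol mu]
   by [sph]. *)
have daE t : J t -> da t = - (S / Vol mu) * b t.
  move=> Jt; apply: (mulIf (lt0r_neq0 V0)).
  have H1 := sph t Jt; have H2 := sph' t Jt; have H3 := wr t Jt.
  rewrite z0 !mulr0 !addr0 in H1 H2.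
  rewrite -[in LHS]H1.
  transitivity (a t * (a t * da t * Vol mu + b t * db t * S)
     - b t * S * (a t * db t - da t * b t)); first by ring.
  rewrite H2 H3; field; exact: lt0r_neq0.
have dbE t : J t -> db t = a t.
  move=> Jt; apply: (mulIf (lt0r_neq0 V0)).
  have H1 := sph t Jt; have H2 := sph' t Jt; have H3 := wr t Jt.
  rewrite z0 !mulr0 !addr0 in H1 H2.
  rewrite -[in LHS]H1.
  transitivity (b t * (a t * da t * Vol mu + b t * db t * S)
     + a t * Vol mu * (a t * db t - da t * b t)); first by ring.
  by rewrite H2 H3; ring.
have S0 : 0 < S.
  rewrite lt_neqAle; apply/andP; split.
    apply/eqP => S0; move/eqP: D0; apply; rewrite /D.
    have dps0 x : dpsi x 0 = 0.
      have cdd := contM dpsi_cont dpsi_cont.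
      have := Rint_eq0 hmu cdd _ (esym S0) x.
      move=> H; have /eqP : dpsi x 0 * dpsi x 0 = 0.
        by apply: H => y; rewrite -expr2 sqr_ge0.
      by rewrite mulf_eq0 orbb => /eqP.
    by rewrite !dps0 mulr0 mul0r subrr.
  rewrite -(mul0r (Vol mu)) -Rint_cst; apply: (Rint_le hmu).
  - by move=> x; exact: cvg_cst.
  - exact: contM.
  - by move=> x; rewrite -expr2 sqr_ge0.
have beta0 : beta != 0 by rewrite gt_eqF// sqrtr_gt0 divr_gt0.
have beta2 : beta ^+ 2 = S / Vol mu by rewrite sqr_sqrtr// ltW// divr_gt0.
have H := harmonic_solution intJ J0 beta0 a0 b0.
split=> // x t Jt; rewrite (psiE x t Jt).
have [|s Js|-> ->] := H _ _ t Jt.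
- by move=> s Js; rewrite beta2 -(daE s Js); exact: (oa s Js).1.
- by rewrite -(dbE s Js); exact: (ob s Js).1.
- by ring.
Qed.

End SphereGeodesic.

Section GreatCircles.
Context {R : realType} {n : nat} (X : closed_kahler R n).
Variable mu : {measure set (borel X) -> \bar R}.
Hypothesis hmu : is_kahler_volume mu.

(** The angular velocity on the sphere: [e^(u/2)] moves with velocity [v e^(u/2) / 2], of norm half
    the Calabi norm of [v], on a sphere of radius [sqrt Vol]. *)
Definition speed (u v : X -> R) : R := Num.sqrt (calabi mu u v v / (4 * Vol mu)).

(* At speed [0] the junk value [sin 0 / 0 = 0] is harmless, since then [v = 0]. *)
Definition circ (u v : X -> R) (t : R) (p : X) : R :=
  cos (speed u v * t) + v p / 2 * (sin (speed u v * t) / speed u v).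

Definition dcirc (u v : X -> R) (t : R) (p : X) : R :=
  - (speed u v * sin (speed u v * t)) + v p / 2 * cos (speed u v * t).

Definition great_circle (u v : X -> R) (t : R) (p : X) : R :=
  u p + 2 * ln (circ u v t p).

Let V0 : 0 < Vol mu := Vol_gt0 hmu.

Lemma calabi_ge0 (u v : X -> R) : continuous u -> continuous v ->
  0 <= calabi mu u v v.
Proof.
move=> cu cv; rewrite -(mul0r (Vol mu)) -Rint_cst; apply: (Rint_le hmu).
- by move=> p; exact: cvg_cst.
- by apply: contM; [exact: contM|exact: cont_expR].
- by move=> p; rewrite mulr_ge0 ?expR_ge0// -expr2 sqr_ge0.
Qed.

Lemma speed_sqr (u v : X -> R) : continuous u -> continuous v ->
  calabi mu u v v = 4 * Vol mu * speed u v ^+ 2.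
Proof.
move=> cu cv; rewrite sqr_sqrtr; first by field; exact: lt0r_neq0.
by rewrite divr_ge0 ?calabi_ge0// mulr_ge0// ltW.
Qed.

Lemma speed0_eq0 (u v : X -> R) : continuous u -> continuous v ->
  speed u v = 0 -> forall p, v p = 0.
Proof.
move=> cu cv s0; have := speed_sqr cu cv; rewrite s0 expr0n mulr0.
by apply: (Rint_sqr_eq0 hmu) => //; [exact: cont_expR|move=> p; exact: expR_gt0].
Qed.

Lemma expR_half (x : R) : expR (x / 2) * expR (x / 2) = expR x.
Proof. by rewrite -expRD -splitr. Qed.

Lemma ddt_val (I : set R) (v : R -> X -> R) (g : R -> R) t p d :
  proper_interval I -> I t -> (forall s, I s -> v s p = g s) ->
  is_derive t 1 g d -> ddt I v t p = d.
Proof.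
move=> pI It vg dg; have PF := proper_interval_dnbhs pI It.
by apply: cvg_lim => //; exact: (interval_derive_lim pI It vg dg).
Qed.

(** Yields uniqueness for the Cauchy problem, as the right-hand side depends on the initial data
    only. Tangency of the initial velocity also comes out, as the orthogonality [z = 0] on the
    sphere. *)
Lemma geodesic_great_circle (J : set R) (u : R -> X -> R) :
  geodesic mu J u -> J 0 ->
  tangent mu (u 0) (ddt J u 0) /\
  forall t, J t -> forall p,
    0 < circ (u 0) (ddt J u 0) t p /\ u t p = great_circle (u 0) (ddt J u 0) t p.
Proof.
move=> [[pJ hu [ O [w [oO JO sw wu]]]] geo] J0.
have sw' : smooth_in O w by exact: sw.
have sw1 := smooth_in_derive sw'.
have w1E t p : J t -> ddt J u t p = 'D_1 (fun s => w s p) t.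
  move=> Jt; apply: (ddt_val pJ Jt _ (smooth_in_is_derive p (JO _ Jt) sw')).
  by move=> s Js; rewrite wu.
have w2E t p : J t ->
    ddt J (ddt J u) t p = 'D_1 (fun s => 'D_1 (fun s => w s p) s) t.
  move=> Jt; apply: (ddt_val pJ Jt _ (smooth_in_is_derive p (JO _ Jt) sw1)).
  by move=> s Js; rewrite w1E.
pose w1 (t : R) p : R := 'D_1 (fun s => w s p) t.
(* The geodesic equation reads [u'' + u'^2 / 2 + 2 k = 0], and [psi = e^(u/2)] has
   [psi'' = psi (u'' / 2 + u'^2 / 4)], whence [psi'' = - k psi]. At this point [k] is not known to
   be constant in time. *)
pose k t := (2 * Vol mu)^-1 * (\int[mu]_q (ddt J u t q * ddt J u t q * expR (u t q))) / 2.
pose psi p t := expR (w t p / 2).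
pose dpsi p t := psi p t * (w1 t p / 2).
have v0E : ddt J u 0 = w1 0 by apply/funext => p; exact: w1E.
have cu0 : continuous (u 0).
  by apply: smooth_fun_continuous; have [] := hu 0 J0.
have sv0 : smooth_fun (w1 0) by exact: smooth_in_fun (JO _ J0) sw1.
have cv0 : continuous (w1 0) by exact: smooth_fun_continuous.
have dpsiE t p : J t -> is_derive t 1 (psi p) (dpsi p t).
  move=> Jt; have d1 := is_derive_scal 2^-1 (smooth_in_is_derive p (JO _ Jt) sw').
  have := @is_derive1_comp _ expR (fun s => 2^-1 * w s p) t _ _ (is_derive_expR _) d1.
  have -> : expR \o (fun s => 2^-1 * w s p) = psi p.
    by apply/funext => s; rewrite /psi /= mulrC.
  move=> H; apply: (is_derive_congr H).
  by rewrite /dpsi /psi /w1 (mulrC _ (w t p)) (mulrC 2^-1).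
have osc p : oscillates J k (psi p) (dpsi p).
  move=> t Jt; split; first exact: dpsiE.
  have d1 := is_derive_scal 2^-1 (smooth_in_is_derive p (JO _ Jt) sw1).
  have H := is_derive_mul (dpsiE t p Jt) d1.
  have -> : dpsi p = (fun s => psi p s * (2^-1 * 'D_1 (fun s => w s p) s)).
    by apply/funext => s; rewrite /dpsi /w1 (mulrC _ 2^-1).
  apply: (is_derive_congr H).
  have G : 'D_1 (fun s => 'D_1 (fun s => w s p) s) t + w1 t p * w1 t p / 2 + 2 * k t = 0.
    rewrite -[RHS](geo t Jt p) /Dt /= w2E// !w1E//; congr (_ + _).
    by rewrite /k mulrC divfK.
  have -> : k t = - ('D_1 (fun s => 'D_1 (fun s => w s p) s) t + w1 t p * w1 t p / 2) / 2.
    by move/eqP: G; rewrite addrC addr_eq0 => /eqP <-; rewrite mulrC mulKf.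
  by rewrite /dpsi /w1; field.
have sph t : J t -> \int[mu]_p (psi p t * psi p t) = Vol mu.
  move=> Jt; have [_ <-] := hu t Jt.
  by apply: eq_Rintegral => p _; rewrite /psi expR_half wu.
have cps : continuous (psi^~ 0).
  apply: cont_expR; rewrite wu// => p.
  by apply: cvgM; [exact: cu0|exact: cvg_cst].
have cdps : continuous (dpsi^~ 0).
  apply: contM => // p.
  by apply: cvgM; [exact: cv0|exact: cvg_cst].
have [z0 H] := sphere_geodesic hmu pJ J0 osc (fun p t _ => expR_gt0 _) cps cdps sph.
have spE : speed (u 0) (ddt J u 0) =
    Num.sqrt ((\int[mu]_p (dpsi p 0 * dpsi p 0)) / Vol mu).
  rewrite /speed; congr (Num.sqrt _).
  suff -> : \int[mu]_p (dpsi p 0 * dpsi p 0) = calabi mu (u 0) (ddt J u 0) (ddt J u 0) / 4.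
    by field; exact: lt0r_neq0.
  have cc : continuous (fun p => ddt J u 0 p * ddt J u 0 p * expR (u 0 p)).
    by rewrite v0E; apply: contM; [exact: contM|exact: cont_expR].
  have := Rint_lin hmu (1 / 4) 0 cc cc; rewrite mul0r addr0 => E.
  rewrite /calabi [RHS]mulrC -[4^-1]mul1r -E; apply: eq_Rintegral => p _.
  by rewrite mul0r addr0 v0E /dpsi /psi -(expR_half (u 0 p)) wu//; field.
split.
  split; first (rewrite v0E; exact: sv0).
  rewrite v0E; move: z0.
  have cc : continuous (fun p => w1 0 p * expR (u 0 p)).
    by apply: contM => //; exact: cont_expR.
  have := Rint_lin hmu (1 / 2) 0 cc cc; rewrite mul0r addr0 => E z0.
  have : 1 / 2 * (\int[mu]_p (w1 0 p * expR (u 0 p))) = 0.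
    rewrite -E -[RHS]z0; apply: eq_Rintegral => p _.
    by rewrite mul0r addr0 /dpsi /psi -(expR_half (u 0 p)) wu//; field.
  by move/eqP; rewrite mulf_eq0 mul1r invr_eq0 pnatr_eq0 => /eqP.
move=> t Jt p.
have cE : psi p t = psi p 0 * circ (u 0) (ddt J u 0) t p.
  rewrite (H p t Jt) /circ spE v0E /dpsi mulrDr; congr (_ + _).
  by rewrite !mulrA.
have c0 : 0 < circ (u 0) (ddt J u 0) t p.
  have : 0 < psi p t by exact: expR_gt0.
  by rewrite cE pmulr_rgt0// expR_gt0.
split=> //; rewrite /great_circle.
have : ln (psi p t) = ln (psi p 0 * circ (u 0) (ddt J u 0) t p) by rewrite cE.
by rewrite lnM ?posrE ?expR_gt0// /psi !expRK !wu//; lra.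
Qed.

End GreatCircles.

Section SmoothCircles.
Context {R : realType} {n : nat} (X : closed_kahler R n).

Lemma open_setX (T U : topologicalType) (A : set T) (B : set U) :
  open A -> open B -> open (A `*` B).
Proof.
move=> oA oB; rewrite openE => -[x y] [Ax By].
exists (A, B); last by case.
by split; exact: open_nbhs_nbhs.
Qed.

Lemma chart_open (c : chart X n) (O : set R) : atlas X c -> open O ->
  open (O `*` ccod c : set (R^o * 'rV[R]_(n + n))).
Proof.
by move=> Xc oO; have [_ oC _ _ _] := atlas_chart Xc; exact: open_setX.
Qed.

Lemma class_C_scal_comp k (O : set R) (a : R) (g : R^o -> R^o) : open O ->
  class_C k setT g -> class_C k O (fun t : R^o => g (a * t)).
Proof.
move=> oO Cg; apply: (@class_C_comp R R^o k O (fun t => a * t) setT g) => //.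
  exact: openT.
apply: class_CM => //; first exact: class_C_cst.
elim: k {Cg} => [|k _]; first by split=> // x _; exact: cvg_id.
apply: (@class_C_is_derive _ _ _ _ _ _ (fun v _ => v)) => //.
- by move=> x _; exact: cvg_id.
- by move=> v; exact: class_C_cst.
Qed.

Lemma smooth_in_circ (v : X -> R) (a b : R) (O : set R) : open O -> smooth_fun v ->
  smooth_in O (fun t p => cos (a * t) + v p / 2 * (sin (a * t) / b)).
Proof.
move=> oO sv c Xc k; have oOC := chart_open Xc oO.
have [Cs Cc] := class_C_sin_cos k (@openT R).
have cst x : class_C k (O `*` ccod c) (cst x : R^o * 'rV[R]_(n + n) -> R^o).
  exact: class_C_cst.
apply: class_CD => //.
  exact: (class_C_fst _ (class_C_scal_comp a oO Cc)).
apply: class_CM => //; apply: class_CM => //.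
- exact: (class_C_snd _ (sv c Xc k)).
- exact: cst.
- exact: (class_C_fst _ (class_C_scal_comp a oO Cs)).
- exact: cst.
Qed.

Lemma smooth_in_ln (w : R -> X -> R) (u : X -> R) (O : set R) : open O ->
  smooth_in O w -> (forall t p, O t -> 0 < w t p) -> smooth_fun u ->
  smooth_in O (fun t p => u p + 2 * ln (w t p)).
Proof.
move=> oO sw w0 su c Xc k; have oOC := chart_open Xc oO.
apply: class_CD => //; first exact: (class_C_snd _ (su c Xc k)).
apply: class_CM => //; first exact: class_C_cst.
have o0 : open [set x : R | 0 < x] by exact: open_gt.
apply: (@class_C_comp R _ k _ (fun tx : R^o * 'rV[R]_(n + n) => w tx.1 (cinv c tx.2) : R^o)
  [set x : R | 0 < x] (@ln R)) => //.
- by move=> [t x] [Ot _]; exact: w0.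
- exact: class_C_ln.
- exact: sw.
Qed.

(** Positivity persists near each [(t, p)], and compactness makes the time neighbourhood uniform in
    [p]. It follows that great circles are positive on an open set of times. *)
Lemma smooth_in_gt0 (O : set R) (w : R -> X -> R) : open O ->
  smooth_in O w -> open [set t | O t /\ forall p, 0 < w t p].
Proof.
move=> oO sw; rewrite openE => t [Ot w0]; apply: filterI; first exact: open_nbhs_nbhs.
have /compact_near_coveringP := @carrier_compact _ _ X.
move=> /(_ R (nbhs t) (fun s p => 0 < w s p) _)[].
  move=> p _.
  have /cvgrPdist_lt/(_ _ (w0 p)) := @smooth_in_continuous _ _ _ O w t p Ot sw.
  case=> -[A B] /= [At Bp] AB; exists (B, A) => //= -[q s] /= [Bq As].
  have /= := AB (s, q) (conj As Bq).
  by move: (w t p) (w s q) => a b; rewrite !ltr_norml; lra.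
move=> e /= e0 eH; near=> s.
by move=> p; apply: (eH s) => //; near: s; exact: nbhsx_ballx.
Unshelve. all: by end_near. Qed.

End SmoothCircles.

(** * The great circle solves the Cauchy problem *)

Section Existence.
Context {R : realType} {n : nat} (X : closed_kahler R n).
Variable mu : {measure set (borel X) -> \bar R}.
Hypothesis hmu : is_kahler_volume mu.
Variables u0 v0 : X -> R.
Hypothesis u0C : calC mu u0.
Hypothesis v0T : tangent mu u0 v0.

Let V0 : 0 < Vol mu := Vol_gt0 hmu.
Let beta := speed mu u0 v0.
Let phi := circ mu u0 v0.
Let dphi := dcirc mu u0 v0.
Let su0 : smooth_fun u0. Proof. by case: u0C. Qed.
Let sv0 : smooth_fun v0. Proof. by case: v0T. Qed.
Let cu0 : continuous u0. Proof. exact: smooth_fun_continuous. Qed.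
Let cv0 : continuous v0. Proof. exact: smooth_fun_continuous. Qed.

Let beta0_v0 : beta = 0 -> forall p, v0 p = 0.
Proof. exact: speed0_eq0. Qed.

Lemma is_derive_circ (t : R) p : is_derive t 1 (fun s => phi s p) (dphi t p).
Proof.
apply: (is_derive_congr (is_derive_add (is_derive_cos_scal beta t)
   (is_derive_scal (v0 p / 2) (is_derive_mul (is_derive_sin_scal beta t)
     (is_derive_cst (beta^-1) t 1))))).
rewrite /dphi /dcirc -/beta /cst; congr (_ + _).
have [b0|bn0] := eqVneq beta 0; first by rewrite beta0_v0// !mul0r.
by field.
Qed.

Lemma is_derive_dcirc (t : R) p :
  is_derive t 1 (fun s => dphi s p) (- beta ^+ 2 * phi t p).
Proof.
apply: (is_derive_congr (is_derive_add
  (is_derive_opp (is_derive_scal beta (is_derive_sin_scal beta t)))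
  (is_derive_scal (v0 p / 2) (is_derive_cos_scal beta t)))).
rewrite /phi /circ -/beta /cst.
have [b0|bn0] := eqVneq beta 0; first by rewrite beta0_v0// b0 !(mul0r, expr0n, oppr0, addr0).
by field.
Qed.

(** In L^2, [f] is the initial position on the sphere and [g] twice the initial velocity. They are
    orthogonal with squared norms [Vol] and [4 Vol beta^2], which settles all integrals along the
    circle. *)
Let f p := expR (u0 p / 2).
Let g p := f p * v0 p.
Let cf : continuous f.
Proof.
by apply: cont_expR => p; apply: cvgM; [exact: cu0|exact: cvg_cst].
Qed.
Let cg : continuous g. Proof. exact: contM. Qed.

Let Iff : \int[mu]_p (f p * f p) = Vol mu.
Proof.
have [_ <-] := u0C; apply: eq_Rintegral => p _; exact: expR_half.
Qed.

Let Ifg : \int[mu]_p (f p * g p) = 0.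
Proof.
have [_ <-] := v0T; apply: eq_Rintegral => p _.
by rewrite /g mulrA /f expR_half mulrC.
Qed.

Let Igg : \int[mu]_p (g p * g p) = 4 * Vol mu * beta ^+ 2.
Proof.
rewrite -(speed_sqr hmu cu0 cv0); apply: eq_Rintegral => p _.
by rewrite -expR_half /g -/(f p); ring.
Qed.

Lemma circ_sphere t : \int[mu]_p (phi t p * phi t p * expR (u0 p)) = Vol mu.
Proof.
have -> : \int[mu]_p (phi t p * phi t p * expR (u0 p)) =
  \int[mu]_p ((cos (beta * t) * f p + (sin (beta * t) / beta / 2) * g p) *
              (cos (beta * t) * f p + (sin (beta * t) / beta / 2) * g p)).
  by apply: eq_Rintegral => p _; rewrite -expR_half -/(f p) /g /phi /circ -/beta; ring.
rewrite (Rint_prod_lin hmu)// Iff Ifg Igg mulr0 addr0.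
have [b0|bn0] := eqVneq beta 0.
  by rewrite b0 mul0r sin0 cos0; ring.
transitivity ((cos (beta * t) ^+ 2 + sin (beta * t) ^+ 2) * Vol mu); first by field.
by rewrite cos2Dsin2 mul1r.
Qed.

Lemma dcirc_sphere t :
  \int[mu]_p (dphi t p * dphi t p * expR (u0 p)) = beta ^+ 2 * Vol mu.
Proof.
have -> : \int[mu]_p (dphi t p * dphi t p * expR (u0 p)) =
  \int[mu]_p ((- (beta * sin (beta * t)) * f p + (cos (beta * t) / 2) * g p) *
              (- (beta * sin (beta * t)) * f p + (cos (beta * t) / 2) * g p)).
  by apply: eq_Rintegral => p _; rewrite -expR_half -/(f p) /g /dphi /dcirc -/beta; ring.
rewrite (Rint_prod_lin hmu)// Iff Ifg Igg mulr0 addr0.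
transitivity ((cos (beta * t) ^+ 2 + sin (beta * t) ^+ 2) * beta ^+ 2 * Vol mu).
  by field.
by rewrite cos2Dsin2 mul1r.
Qed.

Lemma circ0 p : phi 0 p = 1.
Proof. by rewrite /phi /circ mulr0 sin0 cos0 mul0r mulr0 addr0. Qed.

Lemma expR_great_circle t p : 0 < phi t p ->
  expR (great_circle mu u0 v0 t p) = phi t p * phi t p * expR (u0 p).
Proof.
move=> p0; rewrite /great_circle expRD mulrC; congr (_ * _).
by rewrite mulr_natl mulr2n expRD lnK.
Qed.

Lemma is_derive_great_circle (t : R) p : 0 < phi t p ->
  is_derive t 1 (fun s => great_circle mu u0 v0 s p) (2 * (dphi t p / phi t p)).
Proof.
move=> p0.
have dln := @is_derive1_comp _ (@ln R) (fun s => phi s p) t _ _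
   (is_derive1_ln p0) (is_derive_circ t p).
apply: (is_derive_congr (is_derive_add (is_derive_cst (u0 p) t 1)
  (is_derive_scal 2 dln))).
by rewrite add0r (mulrC (dphi _ _)).
Qed.

(** At angle [pi] or [- pi] the sine vanishes and [circ] equals [-1] at every point, whatever [v0]
    is; an interval of positivity containing [0] cannot reach such a time. *)
Lemma circ_lt_pi (I : set R) t : is_interval I -> I 0 ->
  (forall s, I s -> forall p, 0 < phi s p) -> I t -> - pi < beta * t < pi.
Proof.
move=> intI I0 phi0 It; have pi0 := @pi_gt0 R.
have b0 : 0 <= beta by exact: sqrtr_ge0.
have npi s (p : X) : I s -> beta * s = pi -> False.
  move=> Is E; have := phi0 s Is p.
  by rewrite /phi /circ -/beta E sinpi cospi mul0r mulr0 addr0 ltr0N1.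
have nnpi s (p : X) : I s -> beta * s = - pi -> False.
  move=> Is E; have := phi0 s Is p.
  by rewrite /phi /circ -/beta E sinN cosN sinpi cospi oppr0 mul0r mulr0 addr0 ltr0N1.
apply/andP; split; rewrite ltNge; apply/negP => H.
- have bn0 : beta != 0 by apply/eqP => E; move: H; rewrite E mul0r; lra.
  have bp : 0 < beta by rewrite lt_neqAle eq_sym bn0.
  apply: (nnpi (- pi / beta) point); last by field.
  apply: (intI t 0) => //; apply/andP; split.
    by rewrite ler_pdivlMr// mulrC.
  by rewrite ler_pdivrMr// mul0r oppr_le0 ltW.
- have bn0 : beta != 0 by apply/eqP => E; move: H; rewrite E mul0r; lra.
  have bp : 0 < beta by rewrite lt_neqAle eq_sym bn0.
  apply: (npi (pi / beta) point); last by field.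
  apply: (intI 0 t) => //; apply/andP; split.
    by rewrite ler_pdivlMr// mul0r ltW.
  by rewrite ler_pdivrMr// mulrC.
Qed.

Lemma great_circle_cauchy (I : set R) : proper_interval I -> I 0 ->
  (forall t, I t -> forall p, 0 < phi t p) ->
  cauchy_solution mu u0 v0 I (great_circle mu u0 v0).
Proof.
move=> pI I0 phi0.
pose O := [set t | [set: R] t /\ forall p, 0 < phi t p].
have sphi : smooth_in setT phi by apply: smooth_in_circ => //; exact: openT.
have oO : open O by apply: smooth_in_gt0 sphi; exact: openT.
have IO : I `<=` O by move=> t It; split=> //; exact: phi0.
have sU : smooth_in O (great_circle mu u0 v0).
  apply: smooth_in_ln => //; last by move=> t p [_]; exact.
  by apply: smooth_in_circ.
have dU t p : I t -> is_derive t 1 (fun s => great_circle mu u0 v0 s p)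
    (2 * (dphi t p / phi t p)).
  by move=> It; exact: is_derive_great_circle (phi0 t It p).
have U1 t p : I t -> ddt I (great_circle mu u0 v0) t p = 2 * (dphi t p / phi t p).
  by move=> It; exact: (ddt_val pI It (fun s _ => erefl) (dU t p It)).
have U2 t p : I t -> ddt I (ddt I (great_circle mu u0 v0)) t p =
    - (2 * beta ^+ 2) - 2 * (dphi t p / phi t p) ^+ 2.
  move=> It; have p0 := phi0 t It p; have pn0 : phi t p != 0 by rewrite gt_eqF.
  suff d : is_derive t 1 (fun s => 2 * (dphi s p / phi s p))
      (- (2 * beta ^+ 2) - 2 * (dphi t p / phi t p) ^+ 2).
    exact: (ddt_val pI It (fun s Is => U1 s p Is) d).
  have H1 := @is_deriveV _ (fun s => phi s p) t _ 1 pn0 (is_derive_circ t p).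
  have H2 := is_derive_scal 2 (is_derive_mul (is_derive_dcirc t p) H1).
  apply: (is_derive_congr H2).
  by rewrite /GRing.scale /=; field.
have UC t : I t -> calC mu (great_circle mu u0 v0 t).
  move=> It; split; first exact: smooth_in_fun (IO _ It) sU.
  rewrite -[RHS](circ_sphere t); apply: eq_Rintegral => p _.
  by rewrite expR_great_circle//; exact: phi0.
split=> //.
- split; first by split=> //; exists O, (great_circle mu u0 v0).
  move=> t It p; have p0 := phi0 t It p; have pn0 : phi t p != 0 by rewrite gt_eqF.
  rewrite /Dt /= U2// !U1//.
  (* [u'^2 e^u] equals [4 dphi^2 e^(u0)], so the integral is [4 beta^2 Vol] and contributes
     [2 beta^2], which cancels the constant term in [U2]. *)
  set K := (X in _ + _ * X).
  have -> : K = 4 * (beta ^+ 2 * Vol mu).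
    have cd : continuous (fun p => dphi t p * dphi t p * expR (u0 p)).
      have cdp : continuous (dphi t).
        move=> q; apply: cvgD; first exact: cvg_cst.
        apply: cvgM; last exact: cvg_cst.
        by apply: cvgM; [exact: cv0|exact: cvg_cst].
      by apply: contM; [exact: contM|exact: cont_expR].
    have := Rint_lin hmu 4 0 cd cd; rewrite mul0r addr0 dcirc_sphere => <-.
    apply: eq_Rintegral => q _; have q0 := phi0 t It q.
    have qn0 : phi t q != 0 by rewrite gt_eqF.
    by rewrite !U1// expR_great_circle//; field.
  field; rewrite pn0 andbT; exact: lt0r_neq0.
- by apply/funext => p; rewrite /great_circle -/(phi 0 p) circ0 ln1 mulr0 addr0.
- apply/funext => p; rewrite U1// circ0 /dphi /dcirc mulr0 sin0 cos0.
  by field.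
Qed.

End Existence.

(** * Analyticity *)

Section LogSinusoid.
Context {R : realType}.
Variable beta : R.

(* Up to sign, the successive derivatives of a solution of the Riccati equation
   [y' = - (beta ^+ 2 + y ^+ 2)] as polynomials in [y]; the sign is left out to
   keep the coefficients nonnegative. *)
Fixpoint riccati (k : nat) : {poly R} :=
  if k is k'.+1 then (riccati k')^`() * ((beta ^+ 2)%:P + 'X ^+ 2) else 'X.

Lemma riccati_ge0 k i : 0 <= (riccati k)`_i.
Proof.
elim: k i => [|k IH] i /=; first by rewrite coefX ler0n.
rewrite coefM; apply: sumr_ge0 => j _; rewrite mulr_ge0//.
  by rewrite coef_deriv mulrn_wge0.
rewrite coefD coefC coefXn addr_ge0 ?ler0n//.
by case: ifP => // _; exact: sqr_ge0.
Qed.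

Lemma size_riccati k : (size (riccati k) <= k.+2)%N.
Proof.
elim: k => [|k IH] /=; first by rewrite size_polyX.
apply: (leq_trans (size_polyMleq _ _)).
have h : (size ((beta ^+ 2)%:P + 'X ^+ 2 : {poly R})%R <= 3)%N.
  apply: (leq_trans (size_polyD _ _)); rewrite geq_max size_polyXn leqnn andbT.
  by apply: (leq_trans (size_polyC_leq1 _)).
have d : (size (riccati k)^`() <= k.+1)%N.
  have [->|p_neq0] := eqVneq (riccati k) 0; first by rewrite deriv0 size_poly0.
  by rewrite -ltnS (leq_trans _ IH)//; exact: lt_size_deriv.
by have := leq_add d h; rewrite addn3; case: (_ + _)%N.
Qed.

Lemma norm_horner_le (p : {poly R}) (y rho : R) : (forall i, 0 <= p`_i) ->
  `|y| <= rho -> `|p.[y]| <= p.[rho].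
Proof.
move=> p0 yr; rewrite !horner_coef; apply: (le_trans (ler_norm_sum _ _ _)).
apply: ler_sum => i _; rewrite normrM normrX (ger0_norm (p0 i)).
by rewrite ler_wpM2l// lerXn2r// ?nnegrE// (le_trans _ yr).
Qed.

(** With nonnegative coefficients the comparison is termwise: each term of [rho p'(rho)] is the
    corresponding term of [p(rho)] times its degree, at most [k]. *)
Lemma horner_deriv_le (p : {poly R}) (rho : R) k : (forall i, 0 <= p`_i) ->
  0 <= rho -> (size p <= k.+1)%N -> p^`().[rho] * rho <= k%:R * p.[rho].
Proof.
move=> p0 rho0 sp.
have dE : p^`().[rho] = \sum_(i < k) p^`()`_i * rho ^+ i.
  apply: horner_coef_wide.
  have [->|p_neq0] := eqVneq p 0; first by rewrite deriv0 size_poly0.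
  by rewrite -ltnS (leq_trans _ sp)//; exact: lt_size_deriv.
rewrite dE (horner_coef_wide _ sp) big_ord_recl expr0 mulr1 mulrDr mulr_suml mulr_sumr.
apply: ler_wpDl; first by rewrite mulr_ge0.
apply: ler_sum => i _; rewrite coef_deriv -mulrA -exprSr -[p`_i.+1 *+ _]mulr_natl -mulrA.
apply: ler_wpM2r; last by rewrite ler_nat.
by rewrite mulr_ge0 ?exprn_ge0.
Qed.

(** [L] is chosen so that the factor [beta^2 + rho^2] becomes [L rho]. Its [rho] is absorbed by
    [horner_deriv_le], so each step costs a factor [L (k + 1)], and factorial growth follows. *)
Lemma riccati_le (rho L : R) k : 0 < rho -> beta ^+ 2 + rho ^+ 2 = L * rho -> 
  (riccati k).[rho] <= rho * L ^+ k * k`!%:R.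
Proof.
move=> rho0 LE; have L0 : 0 <= L.
  by rewrite -(pmulr_lge0 _ rho0) -LE addr_ge0// sqr_ge0.
elim: k => [|k IH] /=; first by rewrite hornerX expr0 !mulr1.
rewrite hornerM hornerD hornerC hornerXn LE mulrCA mulrC.
rewrite factS natrM exprS.
have := horner_deriv_le (riccati_ge0 k) (ltW rho0) (size_riccati k).
move=> /(ler_wpM2l L0) /le_trans; rewrite [L * (_ * rho)]mulrC; apply.
have := ler_wpM2l (mulr_ge0 L0 (ler0n R k.+1)) IH.
rewrite -[L * k.+1%:R * _]mulrA => /le_trans; apply.
by rewrite le_eqVlt; apply/orP; left; apply/eqP; ring.
Qed.

(** With [y = dphi / phi] the function has derivative [2 y], and [y' = - (beta^2 + y^2)]. Its
    derivatives are thus the polynomials [riccati k] in [y] up to sign and a factor 2, and their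
    bounds feed [taylor_cvg]. *)
Lemma analytic_ln_sinusoid (O : set R) (phi dphi : R -> R) (u : R) : open O ->
  (forall t, O t -> 0 < phi t) ->
  (forall t : R, is_derive t 1 phi (dphi t)) ->
  (forall t : R, is_derive t 1 dphi (- beta ^+ 2 * phi t)) ->
  analytic_on O (fun t => u + 2 * ln (phi t)).
Proof.
move=> oO phi0 d1 d2 t0 Ot0.
pose y t := dphi t / phi t.
pose F k t := if k is k'.+1 then 2 * (-1) ^+ k' * (riccati k').[y t]
              else u + 2 * ln (phi t).
exists (fun k => F k t0 / k`!%:R).
have dy (t : R) : O t -> is_derive t 1 y (- (beta ^+ 2 + y t ^+ 2)).
  move=> Ot; have pn0 : phi t != 0 by rewrite gt_eqF// phi0.
  have H := @is_deriveV _ phi t _ 1 pn0 (d1 t).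
  apply: (is_derive_congr (is_derive_mul (d2 t) H)).
  by rewrite /y /GRing.scale /=; field.
have cy : {for t0, continuous y}.
  have [d _] := dy t0 Ot0.
  exact/differentiable_continuous/derivable1_diffP.
(* A bound for [y] near [t0]. Since [rho <= L], the estimate [2 rho L^k k!] fits under the
   [2 L^(k+1) (k+1)!] that [taylor_cvg] asks for. *)
pose rho := `|y t0| + 1.
have rho0 : 0 < rho by rewrite ltr_wpDl.
have [r /= r0 rH] : nbhs_ball t0 (O `&` [set t | `|y t0 - y t| < 1]).
  apply/nbhs_ballP; apply: filterI; first exact: open_nbhs_nbhs.
  by have /cvgrPdist_lt/(_ 1 ltr01) := cy.
pose L := (beta ^+ 2 + rho ^+ 2) / rho.
have LE : beta ^+ 2 + rho ^+ 2 = L * rho by rewrite divfK// gt_eqF.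
have Lrho : rho <= L.
  by rewrite ler_pdivlMr// -expr2 lerDr sqr_ge0.
have L0 : 0 < L by exact: lt_le_trans Lrho.
apply: (@taylor_cvg _ F t0 r 2 L r0 L0).
- move=> [|k] t /rH[Ot _].
    have dln := @is_derive1_comp _ (@ln R) phi t _ _ (is_derive1_ln (phi0 t Ot)) (d1 t).
    apply: (is_derive_congr (is_derive_add (is_derive_cst u t 1) (is_derive_scal 2 dln))).
    by rewrite add0r /F expr0 mulr1 hornerX /y [dphi t / _]mulrC.
  have H := @is_derive1_comp _ (horner (riccati k)) y t _ _ (is_derive_poly _ _) (dy t Ot).
  apply: (is_derive_congr (is_derive_scal (2 * (-1) ^+ k) H)).
  rewrite /F /= hornerM hornerD hornerC hornerXn [(-1) ^+ k.+1]exprS. ring.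
- move=> k t /rH[Ot /= yt].
  have yrho : `|y t| <= rho.
    rewrite -[y t](subrK (y t0)) (le_trans (ler_normD _ _))// addrC lerD//.
    by rewrite distrC ltW.
  rewrite /F !normrM normrX normrN1 expr1n mulr1 (ger0_norm (ler0n R 2)) -mulrA.
  rewrite ler_wpM2l//.
  apply: (le_trans (norm_horner_le (riccati_ge0 k) yrho)).
  apply: (le_trans (riccati_le k rho0 LE)).
  have Lk : 0 <= L ^+ k by rewrite exprn_ge0// ltW.
  rewrite exprS; apply: ler_pM.
  + by rewrite mulr_ge0// ltW.
  + by rewrite ler0n.
  + exact: ler_wpM2r.
  + by rewrite ler_nat factS leq_pmull.
Qed.

End LogSinusoid.

(** * Jacobi fields *)

Section JacobiFields.
Context {R : realType} {n : nat} (X : closed_kahler R n).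
Variable mu : {measure set (borel X) -> \bar R}.
Hypothesis hmu : is_kahler_volume mu.

Lemma Rint_lin5 (f1 f2 f3 f4 f5 : X -> R) (a1 a2 a3 a4 a5 : R) :
  continuous f1 -> continuous f2 -> continuous f3 -> continuous f4 -> continuous f5 ->
  \int[mu]_p (a1 * f1 p + a2 * f2 p + a3 * f3 p + a4 * f4 p + a5 * f5 p) =
  a1 * (\int[mu]_p f1 p) + a2 * (\int[mu]_p f2 p) + a3 * (\int[mu]_p f3 p)
  + a4 * (\int[mu]_p f4 p) + a5 * (\int[mu]_p f5 p).
Proof.
move=> c1 c2 c3 c4 c5.
have d2 : continuous (fun p => a1 * f1 p + a2 * f2 p) by apply: contD; exact: contZ.
have d3 : continuous (fun p => 1 * (a1 * f1 p + a2 * f2 p) + a3 * f3 p).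
  by apply: contD; exact: contZ.
have d4 : continuous (fun p => 1 * (1 * (a1 * f1 p + a2 * f2 p) + a3 * f3 p) + a4 * f4 p).
  by apply: contD; exact: contZ.
transitivity (\int[mu]_p (1 * (1 * (1 * (a1 * f1 p + a2 * f2 p) + a3 * f3 p) + a4 * f4 p)
    + a5 * f5 p)).
  by apply: eq_Rintegral => p _; rewrite !mul1r.
by rewrite (Rint_lin hmu)// (Rint_lin hmu _ _ d3)// (Rint_lin hmu _ _ d2)// (Rint_lin hmu)// !mul1r.
Qed.

Variables (I : set R) (u J : R -> X -> R).
Hypothesis geo : geodesic mu I u.
Hypothesis I0 : I 0.
Hypothesis jac : jacobi_field mu I u J.

Let u0 := u 0.
Let v0 := ddt I u 0.
Let beta := speed mu u0 v0.
Hypothesis beta_neq0 : beta != 0.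

Let V0 : 0 < Vol mu := Vol_gt0 hmu.
Let pI : proper_interval I. Proof. by case: geo => -[]. Qed.
Let intI : is_interval I. Proof. by case: pI. Qed.
Let u0C : calC mu u0. Proof. by case: geo => -[_ hu _] _; exact: hu. Qed.
Let v0T : tangent mu u0 v0. Proof. by have [] := geodesic_great_circle hmu geo I0. Qed.
Let cu0 : continuous u0. Proof. by apply: smooth_fun_continuous; case: u0C. Qed.
Let cv0 : continuous v0. Proof. by apply: smooth_fun_continuous; case: v0T. Qed.

Let phi := circ mu u0 v0.
Let dphi := dcirc mu u0 v0.
Let E p := expR (u0 p).
Let h p := v0 p / 2.
Let cE : continuous E. Proof. exact: cont_expR. Qed.
Let ch : continuous h.
Proof. by move=> p; apply: cvgM; [exact: cv0|exact: cvg_cst]. Qed.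

Let phi_gt0 t p : I t -> 0 < phi t p.
Proof.
by move=> It; have [_ /(_ t It p)[]] := geodesic_great_circle hmu geo I0.
Qed.

Let uE t : I t -> u t = great_circle mu u0 v0 t.
Proof.
move=> It; apply/funext => p.
by have [_ /(_ t It p)[]] := geodesic_great_circle hmu geo I0.
Qed.

Let expu t p : I t -> expR (u t p) = phi t p * phi t p * E p.
Proof. by move=> It; rewrite uE// expR_great_circle//; exact: phi_gt0. Qed.

Let du t p : I t -> ddt I u t p = 2 * (dphi t p / phi t p).
Proof.
move=> It; apply: (@ddt_val _ _ _ _ _ (fun s => great_circle mu u0 v0 s p) t p _ pI It).
  by move=> s Is; rewrite uE.
exact: (is_derive_great_circle hmu u0C v0T (phi_gt0 p It)).
Qed.

Let NE : \int[mu]_p E p = Vol mu.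
Proof. by case: u0C. Qed.

Let NhE : \int[mu]_p (h p * E p) = 0.
Proof.
have [_ H] := v0T; have c := contM cv0 cE.
have := Rint_lin hmu (1 / 2) 0 c c; rewrite mul0r addr0 H mulr0 => <-.
by apply: eq_Rintegral => p _; rewrite /h; field.
Qed.

Let NhhE : \int[mu]_p (h p * h p * E p) = beta ^+ 2 * Vol mu.
Proof.
have H := speed_sqr hmu cu0 cv0; have c := contM (contM cv0 cv0) cE.
have := Rint_lin hmu (1 / 4) 0 c c; rewrite mul0r addr0.
rewrite -/(calabi mu u0 v0 v0) H -/beta.
have -> : 1 / 4 * (4 * Vol mu * beta ^+ 2) = beta ^+ 2 * Vol mu by field.
by move=> <-; apply: eq_Rintegral => p _; rewrite /h; field.
Qed.

Variables (O : set R) (w : R -> X -> R).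
Hypothesis oO : open O.
Hypothesis IO : I `<=` O.
Hypothesis sw : smooth_in O w.
Hypothesis wJ : forall t, I t -> w t = J t.

Let w1 (t : R) p : R := 'D_1 (fun s => w s p) t.
Let w2 (t : R) p : R := 'D_1 (fun s => w1 s p) t.
Let sw1 : smooth_in O w1 := smooth_in_derive sw.
Let cw t : I t -> continuous (w t).
Proof. by move=> It; exact: smooth_fun_continuous (smooth_in_fun (IO It) sw). Qed.
Let cw1 t : I t -> continuous (w1 t).
Proof. by move=> It; exact: smooth_fun_continuous (smooth_in_fun (IO It) sw1). Qed.

(* For [c = cos (beta t)] and [s = sin (beta t)], [phi * dphi] equals
   [c s (h ^+ 2 / beta - beta) + (c ^+ 2 - s ^+ 2) h]. *)
Let g1 p := (h p * h p / beta - beta) * E p.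
Let g2 p := h p * E p.
Let cg1 : continuous g1.
Proof.
apply: contM => // p; apply: cvgD; last exact: cvg_cst.
by apply: cvgM; [exact: (contM ch ch)|exact: cvg_cst].
Qed.
Let cg2 : continuous g2. Proof. exact: contM. Qed.

(** The integral term of [D_t J]. It is split into fixed weights [g1], [g2] with trigonometric
    coefficients, so that each integrand is [w] times a function of [p] alone, as [is_derive_Rint]
    requires. *)
Let alpha t := (Vol mu)^-1 *
  (cos (beta * t) * sin (beta * t) * (\int[mu]_p (w t p * g1 p)) +
   (cos (beta * t) * cos (beta * t) - sin (beta * t) * sin (beta * t))
     * (\int[mu]_p (w t p * g2 p))).

Let is_derive_alpha (t : R) : I t -> exists da, is_derive t 1 alpha da.
Proof.
move=> It; have d1 := is_derive_Rint hmu oO (IO It) sw cg1.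
have d2 := is_derive_Rint hmu oO (IO It) sw cg2.
have dc := is_derive_cos_scal beta t; have ds := is_derive_sin_scal beta t.
eexists; exact: (is_derive_scal (Vol mu)^-1 (is_derive_add
  (is_derive_mul (is_derive_mul dc ds) d1)
  (is_derive_mul (is_derive_sub (is_derive_mul dc dc) (is_derive_mul ds ds)) d2))).
Qed.

Let int_Jdu t : I t ->
  \int[mu]_q (J t q * ddt I u t q * expR (u t q)) = 2 * Vol mu * alpha t.
Proof.
move=> It.
have Vn0 : Vol mu != 0 by exact: lt0r_neq0.
rewrite /alpha -(mulrA 2) (mulrA (Vol mu)) divff// mul1r.
rewrite -(Rint_lin hmu); [|exact: (contM (cw It) cg1)|exact: (contM (cw It) cg2)].
have cc : continuous (fun q => cos (beta * t) * sin (beta * t) * (w t q * g1 q) +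
    (cos (beta * t) * cos (beta * t) - sin (beta * t) * sin (beta * t)) * (w t q * g2 q)).
  by apply: contD; apply: contZ; [exact: (contM (cw It) cg1)|exact: (contM (cw It) cg2)].
have := Rint_lin hmu 2 0 cc cc; rewrite mul0r addr0 => <-.
apply: eq_Rintegral => q _; rewrite -wJ// du// expu//.
have pn0 : phi t q != 0 by rewrite gt_eqF// phi_gt0.
transitivity (2 * w t q * (phi t q * dphi t q) * E q); first by field.
rewrite /phi /dphi /circ /dcirc -/beta -/(h q) /g1 /g2.
by field.
Qed.

Let DtJ t p : I t -> Dt mu I u J t p = w1 t p + w t p * (dphi t p / phi t p) + alpha t.
Proof.
move=> It; rewrite /Dt /= int_Jdu//.
have -> : ddt I J t p = w1 t p.
  apply: (ddt_val pI It _ (smooth_in_is_derive p (IO It) sw)).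
  by move=> s Is; rewrite wJ.
have pn0 : phi t p != 0 by rewrite gt_eqF// phi_gt0.
by rewrite du// -wJ//; field; rewrite pn0 lt0r_neq0.
Qed.

(** After division by [phi], the terms with undifferentiated [w] cancel against the curvature, and
    so do those with [alpha]. Among the integral terms there remain only [alpha'] and the outer
    integral of [D_t], both functions of time alone; their sum is [b]. *)
Lemma jacobi_equation : exists b : R -> R, forall t, I t -> forall p,
  w2 t p * phi t p + 2 * w1 t p * dphi t p + b t * phi t p = 0.
Proof.
(* The value of [b] is chosen separately for each time, so [b] carries no regularity. *)
suff H t : exists b, I t -> forall p,
    w2 t p * phi t p + 2 * w1 t p * dphi t p + b * phi t p = 0.
  by exists (fun t => projT1 (cid (H t))) => t It; exact: (projT2 (cid (H t))).
have [It|nIt] := pselect (I t); last by exists 0.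
have [da dalpha] := is_derive_alpha It.
pose gam := (2 * Vol mu)^-1 *
  \int[mu]_q (Dt mu I u J t q * ddt I u t q * expR (u t q)).
exists (da + gam) => _ p.
have pn0 : phi t p != 0 by rewrite gt_eqF// phi_gt0.
have dJ : ddt I (Dt mu I u J) t p = w2 t p + w1 t p * (dphi t p / phi t p)
    - w t p * (beta ^+ 2 + (dphi t p / phi t p) ^+ 2) + da.
  suff d : is_derive t 1 (fun s => w1 s p + w s p * (dphi s p / phi s p) + alpha s)
    (w2 t p + w1 t p * (dphi t p / phi t p)
      - w t p * (beta ^+ 2 + (dphi t p / phi t p) ^+ 2) + da).
    exact: (ddt_val pI It (fun s Is => DtJ p Is) d).
  have d1 := smooth_in_is_derive p (IO It) sw.
  have d2 := smooth_in_is_derive p (IO It) sw1.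
  have dp := is_derive_circ hmu u0C v0T t p.
  have ddp := is_derive_dcirc hmu u0C v0T t p.
  have di := @is_deriveV _ (fun s => phi s p) t _ 1 pn0 dp.
  apply: (is_derive_congr (is_derive_add (is_derive_add d2
    (is_derive_mul d1 (is_derive_mul ddp di))) dalpha)).
  rewrite -/phi -/dphi -/beta -/(w1 t p) -/(w2 t p) /GRing.scale /=.
  by field.
have [_ /(_ t It p)] := jac.
rewrite {1}/Dt /= dJ -/gam (DtJ p It) du// /curvature.
have -> : calabi mu (u t) (J t) (ddt I u t) = 2 * Vol mu * alpha t by exact: int_Jdu.
have -> : calabi mu (u t) (ddt I u t) (ddt I u t) = 4 * (beta ^+ 2 * Vol mu).
  have cd : continuous (fun p => dphi t p * dphi t p * expR (u0 p)).
    have cdp : continuous (dphi t).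
      move=> q; apply: cvgD; first exact: cvg_cst.
      by apply: cvgM; [exact: ch|exact: cvg_cst].
    by apply: contM; [exact: contM|exact: cont_expR].
  have := Rint_lin hmu 4 0 cd cd; rewrite mul0r addr0 (dcirc_sphere hmu u0C v0T) => <-.
  apply: eq_Rintegral => q _; have qn0 : phi t q != 0 by rewrite gt_eqF// phi_gt0.
  by rewrite du// expu// -/(E q); field.
rewrite du// -(wJ It) => H.
transitivity (phi t p * (w2 t p + w1 t p * (dphi t p / phi t p)
    - w t p * (beta ^+ 2 + (dphi t p / phi t p) ^+ 2) + da +
  (w1 t p + w t p * (dphi t p / phi t p) + alpha t) * (2 * (dphi t p / phi t p)) / 2 +
  gam - (4 * Vol mu)^-1 * (2 * Vol mu * alpha t * (2 * (dphi t p / phi t p)) -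
    4 * (beta ^+ 2 * Vol mu) * w t p))).
  by field; rewrite pn0 lt0r_neq0.
by rewrite H mulr0.
Qed.

Lemma jacobi_eq0 t0 : I t0 -> t0 != 0 -> J 0 = cst 0 -> J t0 = cst 0 ->
  forall t, I t -> forall p, J t p = 0.
Proof.
move=> It0 t0n0 J0 Jt0.
have Vn0 : Vol mu != 0 by exact: lt0r_neq0.
have [b jeq] := jacobi_equation.
pose c t := cos (beta * t); pose s t := beta^-1 * sin (beta * t).
have dc (t : R) : is_derive t 1 c (- beta ^+ 2 * s t).
  by apply: (is_derive_congr (is_derive_cos_scal beta t)); rewrite /s; field.
have ds (t : R) : is_derive t 1 s (c t).
  by apply: (is_derive_congr (is_derive_scal beta^-1 (is_derive_sin_scal beta t)));
    rewrite /c; field.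
have c0 : c 0 = 1 by rewrite /c mulr0 cos0.
have s0 : s 0 = 0 by rewrite /s mulr0 sin0 mulr0.
have cs1 t : c t ^+ 2 + beta ^+ 2 * s t ^+ 2 = 1.
  by rewrite -(cos2Dsin2 (beta * t)) /c /s; field.
have phiE t p : phi t p = c t + h p * s t.
  by rewrite /phi /circ -/beta /c /s /h; field.
have dphiE t p : dphi t p = - beta ^+ 2 * s t + h p * c t.
  by rewrite /dphi /dcirc -/beta /c /s /h; field.
pose zeta p := w1 0 p.
have w0 p : w 0 p = 0 by rewrite wJ// J0.
(* Removing the free oscillation with velocity [zeta] leaves zero initial data and the forcing
   [- b (c + h s)]. *)
pose r p t := w t p * phi t p - zeta p * s t.
pose dr p t := w1 t p * phi t p + w t p * dphi t p - zeta p * c t.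
have r0 p : r p 0 = 0 by rewrite /r w0 s0; ring.
have dr0 p : dr p 0 = 0 by rewrite /dr w0 phiE c0 s0 /zeta; ring.
have drE p t : I t -> is_derive t 1 (r p) (dr p t).
  move=> It.
  apply: (is_derive_congr (is_derive_sub
    (is_derive_mul (smooth_in_is_derive p (IO It) sw) (is_derive_circ hmu u0C v0T t p))
    (is_derive_scal (zeta p) (ds t)))).
  by rewrite -/phi -/dphi /dr /w1; ring.
have ddrE p t : I t -> is_derive t 1 (dr p) (- beta ^+ 2 * r p t - b t * phi t p).
  move=> It.
  have d1 := smooth_in_is_derive p (IO It) sw.
  have d2 := smooth_in_is_derive p (IO It) sw1.
  have dp := is_derive_circ hmu u0C v0T t p.
  have ddp := is_derive_dcirc hmu u0C v0T t p.
  apply: (is_derive_congr (is_derive_sub (is_derive_add (is_derive_mul d2 dp)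
    (is_derive_mul d1 ddp)) (is_derive_scal (zeta p) (dc t)))).
  have := jeq t It p; rewrite -/phi -/dphi -/beta -/(w1 t p) -/(w2 t p) /r => e.
  by rewrite -[RHS]addr0 -e; ring.
have [p [q hpq]] : exists p q, h p - h q != 0.
  apply: contrapT => H; move/eqP: beta_neq0; apply.
  have hc p : h p = h point.
    apply/eqP; rewrite -subr_eq0; apply/negPn/negP => hp.
    by apply: H; exists p, point.
  have h0 : h point = 0.
    have := NhE; have -> : \int[mu]_p (h p * E p) = h point * Vol mu.
      have := Rint_lin hmu (h point) 0 cE cE; rewrite mul0r addr0 NE => <-.
      by apply: eq_Rintegral => x _; rewrite (hc x) mul0r addr0.
    by move/eqP; rewrite mulf_eq0 (negPf Vn0) orbF => /eqP.
  have := NhhE; have -> : \int[mu]_p (h p * h p * E p) = 0.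
    rewrite -(mul0r (Vol mu)) -Rint_cst.
    by apply: eq_Rintegral => x _; rewrite (hc x) h0 !mul0r.
  move/esym/eqP; rewrite mulf_eq0 (negPf Vn0) orbF.
  by rewrite expf_eq0 => /eqP.
pose B t := (h p - h q)^-1 * (r p t - r q t).
pose dB t := (h p - h q)^-1 * (dr p t - dr q t).
pose A t := r p t - h p * B t.
pose dA t := dr p t - h p * dB t.
have B0 : B 0 = 0 by rewrite /B !r0 subrr mulr0.
have dB0 : dB 0 = 0 by rewrite /dB !dr0 subrr mulr0.
have A0 : A 0 = 0 by rewrite /A r0 B0 mulr0 subrr.
have dA0 : dA 0 = 0 by rewrite /dA dr0 dB0 mulr0 subrr.
have dBE t : I t -> is_derive t 1 B (dB t).
  by move=> It; apply: is_derive_scal; apply: is_derive_sub; exact: drE.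
have ddBE t : I t -> is_derive t 1 dB (- beta ^+ 2 * B t - b t * s t).
  move=> It; apply: (is_derive_congr (is_derive_scal (h p - h q)^-1
    (is_derive_sub (ddrE p t It) (ddrE q t It)))).
  by rewrite !phiE /B; field.
have dAE t : I t -> is_derive t 1 A (dA t).
  by move=> It; apply: is_derive_sub; [exact: drE|apply: is_derive_scal; exact: dBE].
have ddAE t : I t -> is_derive t 1 dA (- beta ^+ 2 * A t - b t * c t).
  move=> It; apply: (is_derive_congr (is_derive_sub (ddrE p t It)
    (is_derive_scal (h p) (ddBE t It)))).
  by rewrite phiE /A; ring.
have oc : oscillates I (fun=> beta ^+ 2) c (fun t => - beta ^+ 2 * s t).
  move=> t It; split; first exact: dc.
  exact: (is_derive_scal (- beta ^+ 2) (ds t)).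
have os : oscillates I (fun=> beta ^+ 2) s c by move=> t It; split; [exact: ds|exact: dc].
have decomp x t : I t -> w t x * phi t x = zeta x * s t + A t + h x * B t.
  move=> It.
  have oy : oscillates I (fun=> beta ^+ 2) (fun t => r x t - A t - h x * B t)
      (fun t => dr x t - dA t - h x * dB t).
    move=> y Iy; split.
      by apply: is_derive_sub; [apply: is_derive_sub; [exact: drE|exact: dAE]|
        apply: is_derive_scal; exact: dBE].
    apply: (is_derive_congr (is_derive_sub (is_derive_sub (ddrE x y Iy) (ddAE y Iy))
      (is_derive_scal (h x) (ddBE y Iy)))).
    by rewrite phiE; ring.
  have := oscillates_unique intI I0 oy oc os _ _ _ It.
  rewrite c0 s0 !mulr0 subr0 mulr1 oner_eq0 r0 dr0 A0 B0 dA0 dB0 !mulr0 !subr0.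
  by move=> /(_ isT erefl erefl); rewrite /r => H; apply/subr0_eq; rewrite -[RHS]H; ring.
pose Z1 := \int[mu]_p (zeta p * E p).
pose Z2 := \int[mu]_p (zeta p * (h p * E p)).
have czeta : continuous zeta by exact: cw1.
have cz1 := contM czeta cE; have chE := contM ch cE; have cz2 := contM czeta chE.
have chhE := contM (contM ch ch) cE.
have tang t : I t -> s t * c t * Z1 + s t ^+ 2 * Z2 +
    (A t * c t + beta ^+ 2 * (B t * s t)) * Vol mu = 0.
  move=> It; have [[/(_ t It)[_ H] _] _] := jac.
  rewrite -[RHS]H.
  transitivity (\int[mu]_p ((s t * c t) * (zeta p * E p) + (s t ^+ 2) * (zeta p * (h p * E p))
    + (A t * c t) * E p + (A t * s t + B t * c t) * (h p * E p)
    + (B t * s t) * (h p * h p * E p))).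
    by rewrite (Rint_lin5 _ _ _ _ _ cz1 cz2 cE chE chhE) NE NhE NhhE -/Z1 -/Z2; ring.
  apply: eq_Rintegral => x _; rewrite expu// -wJ//.
  transitivity (w t x * phi t x * phi t x * E x); last by ring.
  by rewrite decomp// phiE; ring.
(* The derivative of [tang] at [0], where all terms but the first vanish to second order. *)
have Z10 : Z1 = 0.
  pose f t := Z1 * (s t * c t) + Z2 * (s t * s t) +
    Vol mu * (A t * c t + beta ^+ 2 * (B t * s t)).
  have df : is_derive (0 : R) 1 f Z1.
    have dsc := is_derive_mul (ds 0) (dc 0).
    have dss := is_derive_mul (ds 0) (ds 0).
    have dAc := is_derive_mul (dAE 0 I0) (dc 0).
    have dBs := is_derive_mul (dBE 0 I0) (ds 0).
    apply: (is_derive_congr (is_derive_add (is_derive_add (is_derive_scal Z1 dsc)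
      (is_derive_scal Z2 dss)) (is_derive_scal (Vol mu)
        (is_derive_add dAc (is_derive_scal (beta ^+ 2) dBs))))).
    by rewrite c0 s0 A0 B0 dA0 dB0; ring.
  apply: (@interval_derive_unique _ I 0 f (cst 0) _ _ pI I0 _ df).
  by move=> t It; rewrite /f -[RHS](tang t It); ring.
(* [P] and [Q] are the coordinates of [(A, beta B)] in the rotating frame: tangency
   prescribes [P], and then [Q' = - 2 P]. *)
pose P t := c t * A t + beta ^+ 2 * (s t * B t).
pose Q t := c t * B t - s t * A t.
have PE t : I t -> P t = - (s t ^+ 2 * Z2) / Vol mu.
  move=> It; apply: (mulIf Vn0); rewrite divfK//; apply/eqP; rewrite -addr_eq0; apply/eqP.
  by rewrite -[RHS](tang t It) Z10 /P; ring.
have first_integral t : I t -> c t * dB t - s t * dA t + P t = 0.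
  move=> It; pose f t := c t * dB t - s t * dA t + P t.
  suff : f t = f 0 by rewrite /f => ->; rewrite /P s0 A0 dB0; ring.
  apply: (interval_derive0_cst intI It I0) => y Iy.
  apply: (is_derive_congr (is_derive_add (is_derive_sub
      (is_derive_mul (dc y) (ddBE y Iy)) (is_derive_mul (ds y) (ddAE y Iy)))
    (is_derive_add (is_derive_mul (dc y) (dAE y Iy))
      (is_derive_scal (beta ^+ 2) (is_derive_mul (ds y) (dBE y Iy)))))).
  by ring.
(* By [first_integral] and [PE], [Q' = - 2 P = 2 s^2 Z2 / Vol], while [t - s c] has derivative
   [2 beta^2 s^2]. *)
have QE t : I t -> Q t = Z2 / (Vol mu * beta ^+ 2) * (t - s t * c t).
  move=> It; apply/subr0_eq.
  pose f t := Q t - Z2 / (Vol mu * beta ^+ 2) * (t - s t * c t).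
  suff : f t = f 0 by rewrite /f => ->; rewrite /Q s0 B0; ring.
  apply: (interval_derive0_cst intI It I0) => y Iy.
  apply: (is_derive_congr (is_derive_sub (is_derive_sub
      (is_derive_mul (dc y) (dBE y Iy)) (is_derive_mul (ds y) (dAE y Iy)))
    (is_derive_scal (Z2 / (Vol mu * beta ^+ 2))
      (is_derive_sub (is_derive_id y 1) (is_derive_mul (ds y) (dc y)))))).
  have -> : c y * dB y + B y * (- beta ^+ 2 * s y) - (s y * dA y + A y * c y) =
    c y * dB y - s y * dA y + P y - 2 * P y by rewrite /P; ring.
  rewrite first_integral// PE//.
  have -> : 1 - (s y * (- beta ^+ 2 * s y) + c y * c y) = 2 * (beta ^+ 2 * s y ^+ 2).
    by rewrite -[X in X - _](cs1 y); ring.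
  by field; rewrite Vn0 beta_neq0.
have wt0 x : w t0 x = 0 by rewrite wJ// Jt0.
have st0 : s t0 != 0.
  rewrite mulf_neq0 ?invr_eq0//.
  have /andP[lo hi] := circ_lt_pi intI I0 (fun t It p => phi_gt0 p It) It0.
  have [bt|bt|bt] := ltgtP 0 (beta * t0).
  - by rewrite gt_eqF// sin_gt0_pi// bt hi.
  - by rewrite -[beta * t0]opprK sinN oppr_eq0 gt_eqF// sin_gt0_pi// oppr_gt0 bt ltrNl.
  - by move/esym/eqP: bt; rewrite mulf_eq0 (negPf beta_neq0) (negPf t0n0).
have z_t0 x : zeta x * s t0 + A t0 + h x * B t0 = 0.
  by rewrite -decomp// wt0 mul0r.
have int0 : \int[mu]_p (0 : R) = 0 by rewrite Rint_cst mul0r.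
(* Integrating [z_t0] against [E], and below against [h E], gives one equation for [A t0] and one
   relating [Z2] to [B t0]. *)
have At0 : A t0 = 0.
  apply: (mulIf Vn0); rewrite mul0r.
  transitivity (\int[mu]_p (s t0 * (zeta p * E p) + 0 * (zeta p * (h p * E p))
    + A t0 * E p + B t0 * (h p * E p) + 0 * (h p * h p * E p))).
    by rewrite (Rint_lin5 _ _ _ _ _ cz1 cz2 cE chE chhE) NE NhE -/Z1 Z10; ring.
  rewrite -[RHS]int0; apply: eq_Rintegral => x _.
  by rewrite -[RHS](mul0r (E x)) -[X in _ = X * _](z_t0 x); ring.
have Z2E : s t0 * Z2 + beta ^+ 2 * Vol mu * B t0 = 0.
  transitivity (\int[mu]_p (0 * (zeta p * E p) + s t0 * (zeta p * (h p * E p))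
    + 0 * E p + A t0 * (h p * E p) + B t0 * (h p * h p * E p))).
    by rewrite (Rint_lin5 _ _ _ _ _ cz1 cz2 cE chE chhE) NhE NhhE -/Z2; ring.
  rewrite -[RHS]int0; apply: eq_Rintegral => x _.
  by rewrite -[RHS](mul0r (h x * E x)) -[X in _ = X * _](z_t0 x); ring.
(* Inserting [Z2] from [Z2E] into [QE] makes the trigonometric terms cancel and leaves
   [B t0 * t0 = 0]. *)
have Bt0 : B t0 = 0.
  apply: (mulIf t0n0); rewrite mul0r.
  have H := QE t0 It0; rewrite /Q At0 mulr0 subr0 in H.
  have Z2E' : Z2 = - (beta ^+ 2 * Vol mu * B t0) / s t0.
    apply: (mulIf st0); rewrite divfK//; apply/eqP; rewrite -addr_eq0; apply/eqP.
    by rewrite -[RHS]Z2E; ring.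
  have : s t0 * (c t0 * B t0) = - B t0 * (t0 - s t0 * c t0).
    by rewrite H Z2E'; field; rewrite Vn0 beta_neq0 st0.
  by move=> H2; rewrite -[RHS](subrr (s t0 * (c t0 * B t0))) {2}H2; ring.
have Z20 : Z2 = 0.
  by move/eqP: Z2E; rewrite Bt0 mulr0 addr0 mulf_eq0 (negPf st0) => /eqP.
have zeta0 x : zeta x = 0.
  by have /eqP := z_t0 x; rewrite At0 Bt0 mulr0 !addr0 mulf_eq0 (negPf st0) orbF => /eqP.
move=> t It x.
have P0 : P t = 0 by rewrite PE// Z20 mulr0 oppr0 mul0r.
have Q0 : Q t = 0 by rewrite QE// Z20 !mul0r.
have At : A t = 0.
  rewrite -[LHS]mulr1 -(cs1 t).
  transitivity (c t * P t - beta ^+ 2 * s t * Q t); first by rewrite /P /Q; ring.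
  by rewrite P0 Q0 !mulr0 subrr.
have Bt : B t = 0.
  rewrite -[LHS]mulr1 -(cs1 t).
  transitivity (c t * Q t + s t * P t); first by rewrite /P /Q; ring.
  by rewrite P0 Q0 !mulr0 addr0.
have /eqP := decomp x t It; rewrite zeta0 At Bt mul0r mulr0 !addr0 mulf_eq0.
by rewrite (gt_eqF (phi_gt0 x It)) orbF -wJ// => /eqP.
Qed.

End JacobiFields.

(** * The exponential map *)

Section Exponential.
Context {R : realType} {n : nat} (X : closed_kahler R n).
Variable mu : {measure set (borel X) -> \bar R}.
Hypothesis hmu : is_kahler_volume mu.

Let V0 : 0 < Vol mu := Vol_gt0 hmu.

Lemma cauchy_great_circle (u0 v0 : X -> R) (J : set R) (w : R -> X -> R) :
  cauchy_solution mu u0 v0 J w -> forall t, J t ->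
  (forall p, 0 < circ mu u0 v0 t p) /\ w t = great_circle mu u0 v0 t.
Proof.
move=> [J0 geo w0 dw0] t Jt.
have [_ /(_ t Jt)] := geodesic_great_circle hmu geo J0; rewrite w0 dw0 => H.
by split=> [p|]; [have [] := H p|apply/funext => p; have [] := H p].
Qed.

Lemma proper_interval01 : proper_interval (`[0, 1]%classic : set R).
Proof.
split; first exact: interval_is_interval.
by exists 0, 1; rewrite /= !in_itv /= !lexx ler01 ltr01.
Qed.

Lemma calabi_expE (u0 v0 : X -> R) : exp_dom mu u0 v0 ->
  calabi_exp mu u0 v0 = great_circle mu u0 v0 1.
Proof.
move=> [_ [u hu]]; have I1 : (`[0, 1]%classic : set R) 1 by rewrite /= in_itv /= ler01 lexx.
have [_ u1E] := cauchy_great_circle hu I1.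
rewrite -u1E; apply: xget_unique; first by exists u.
by move=> _ [w hw <-]; have [_ ->] := cauchy_great_circle hw I1.
Qed.

Lemma exp_dom_gt0 (u0 v0 : X -> R) t : exp_dom mu u0 v0 -> 0 <= t <= 1 ->
  forall p, 0 < circ mu u0 v0 t p.
Proof.
move=> [_ [u hu]] t01; have It : (`[0, 1]%classic : set R) t by rewrite /= in_itv.
by have [] := cauchy_great_circle hu It.
Qed.

Lemma calabi_exp_fun (u0 : X -> R) : calC mu u0 ->
  set_fun (exp_dom mu u0) (calC mu) (calabi_exp mu u0).
Proof.
move=> u0C v hv; rewrite calabi_expE//; have [_ [u hu]] := hv.
have I1 : (`[0, 1]%classic : set R) 1 by rewrite /= in_itv /= ler01 lexx.
have [_ <-] := cauchy_great_circle hu I1.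
by have [_ [[_ + _] _] _ _] := hu; apply.
Qed.

Lemma int_circ (u0 v0 : X -> R) t : calC mu u0 -> tangent mu u0 v0 ->
  \int[mu]_p (circ mu u0 v0 t p * expR (u0 p)) = cos (speed mu u0 v0 * t) * Vol mu.
Proof.
move=> [su0 Iu0] [sv0 Iv0].
have cE := cont_expR (smooth_fun_continuous su0).
have cvE := contM (smooth_fun_continuous sv0) cE.
have := Rint_lin hmu (cos (speed mu u0 v0 * t))
  (sin (speed mu u0 v0 * t) / speed mu u0 v0 / 2) cE cvE.
rewrite Iu0 Iv0 mulr0 addr0 => <-.
by apply: eq_Rintegral => p _; rewrite /circ; ring.
Qed.

Lemma exp_dom_speed (u0 v0 : X -> R) : calC mu u0 -> exp_dom mu u0 v0 ->
  0 <= speed mu u0 v0 < pi.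
Proof.
move=> u0C hv; rewrite sqrtr_ge0 /=.
have I0 : (`[0, 1]%classic : set R) 0 by rewrite /= in_itv /= ler01 lexx.
have I1 : (`[0, 1]%classic : set R) 1 by rewrite /= in_itv /= ler01 lexx.
have [intI _] := proper_interval01.
have pos s : (`[0, 1]%classic : set R) s -> forall p, 0 < circ mu u0 v0 s p.
  by rewrite /= in_itv /= => s01; exact: exp_dom_gt0.
by have /andP[_] := circ_lt_pi intI I0 pos I1; rewrite mulr1.
Qed.

Lemma calabi_exp_inj (u0 : X -> R) : calC mu u0 ->
  set_inj (exp_dom mu u0) (calabi_exp mu u0).
Proof.
move=> u0C v w /set_mem hv /set_mem hw; rewrite !calabi_expE// => E.
have [vT _] := hv; have [wT _] := hw.
have cu0 : continuous u0 by apply: smooth_fun_continuous; case: u0C.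
have cv : continuous v by apply: smooth_fun_continuous; case: vT.
have cw : continuous w by apply: smooth_fun_continuous; case: wT.
have circE p : circ mu u0 v 1 p = circ mu u0 w 1 p.
  have := congr1 (fun f => f p) E; rewrite /great_circle => /addrI.
  move=> /(mulfI _) H; apply: ln_inj; rewrite ?posrE.
  - by apply: exp_dom_gt0 hv _ _; rewrite ler01 lexx.
  - by apply: exp_dom_gt0 hw _ _; rewrite ler01 lexx.
  - by apply: H; rewrite pnatr_eq0.
(* Both speeds lie in [[0, pi)], where the cosine is injective; [int_circ] reads that cosine off the
   common end point. *)
have spE : speed mu u0 v = speed mu u0 w.
  have /andP[v0 vpi] := exp_dom_speed u0C hv.
  have /andP[w0 wpi] := exp_dom_speed u0C hw.
  rewrite -[LHS]cosK ?in_itv/= ?v0 ?ltW// -[RHS]cosK ?in_itv/= ?w0 ?ltW//.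
  congr acos; apply: (mulIf (lt0r_neq0 V0)).
  have := int_circ 1 u0C vT; have := int_circ 1 u0C wT.
  by rewrite !mulr1 => <- <-; apply: eq_Rintegral => p _; rewrite circE.
apply/funext => p.
have [b0|bn0] := eqVneq (speed mu u0 w) 0.
  by rewrite (speed0_eq0 hmu cu0 cw b0) (speed0_eq0 hmu cu0 cv)// spE.
have /andP[w0 wpi] := exp_dom_speed u0C hw.
have sn0 : sin (speed mu u0 w) != 0.
  by rewrite gt_eqF// sin_gt0_pi// wpi lt_neqAle eq_sym bn0 w0.
have := circE p; rewrite /circ spE mulr1 => /addrI/(mulIf _).
rewrite mulf_neq0 ?invr_eq0// => /(_ isT).
by move=> /(mulIf _); rewrite invr_eq0 pnatr_eq0; exact.
Qed.

Lemma smooth_fun_lin_expR (u0 u1 : X -> R) (a b : R) :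
  smooth_fun u0 -> smooth_fun u1 ->
  smooth_fun (fun p => a * (expR ((u1 p - u0 p) / 2) + b)).
Proof.
move=> s0 s1 c Xc k; have [_ oC _ _ _] := atlas_chart Xc.
have cst x : class_C k (ccod c) (cst x : 'rV[R]_(n + n) -> R^o) by exact: class_C_cst.
apply: class_CM => //; first exact: cst.
apply: class_CD => //; last exact: cst.
apply: (@class_C_comp R _ k _ (fun x => (u1 (cinv c x) - u0 (cinv c x)) / 2 : R^o)
  setT (@expR R)) => //; first exact: openT.
  by apply: class_C_expR; exact: openT.
apply: class_CM => //; last exact: cst.
apply: class_CD => //; first exact: s1.
by apply: class_CN => //; exact: s0.
Qed.

(** The half exponentials of [u0] and [u1] are positive functions on the sphere at an angle [k] with
    cosine [c] in [[0, 1]]. The shorter great arc joining them consists of positive combinations, so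
    it stays in the image of C. *)
Lemma calabi_exp_surj (u0 : X -> R) : calC mu u0 ->
  set_surj (exp_dom mu u0) (calC mu) (calabi_exp mu u0).
Proof.
move=> u0C u1 u1C.
have [su0 Iu0] := u0C; have [su1 Iu1] := u1C.
have cu0 := smooth_fun_continuous su0; have cu1 := smooth_fun_continuous su1.
have Vn0 : Vol mu != 0 by exact: lt0r_neq0.
have pI := proper_interval01.
have I0 : (`[0, 1]%classic : set R) 0 by rewrite /= in_itv /= ler01 lexx.
suff [v [vT vpos vE]] : exists v, [/\ tangent mu u0 v,
    forall t, (`[0, 1]%classic : set R) t -> forall p, 0 < circ mu u0 v t p &
    great_circle mu u0 v 1 = u1].
  have hv : exp_dom mu u0 v.
    by split=> //; exists (great_circle mu u0 v); exact: great_circle_cauchy.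
  by exists v => //; rewrite calabi_expE.
pose f p := expR (u0 p / 2); pose g p := expR (u1 p / 2).
have half (u : X -> R) : continuous u -> continuous (fun p => expR (u p / 2)).
  move=> cu; apply: cont_expR => p; apply: cvgM; [exact: cu|exact: cvg_cst].
have cf : continuous f by exact: half.
have cg : continuous g by exact: half.
have Iff : \int[mu]_p (f p * f p) = Vol mu.
  by rewrite -[RHS]Iu0; apply: eq_Rintegral => p _; exact: expR_half.
have Igg : \int[mu]_p (g p * g p) = Vol mu.
  by rewrite -[RHS]Iu1; apply: eq_Rintegral => p _; exact: expR_half.
pose c := (\int[mu]_p (f p * g p)) / Vol mu.
have Ifg : \int[mu]_p (f p * g p) = c * Vol mu by rewrite divfK.
have Isub : \int[mu]_p ((1 * f p + (-1) * g p) * (1 * f p + (-1) * g p)) =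
    2 * Vol mu * (1 - c).
  by rewrite (Rint_prod_lin hmu)// Iff Igg Ifg; ring.
have csub : continuous (fun p => (1 * f p + (-1) * g p) * (1 * f p + (-1) * g p)).
  by apply: contM; apply: contD; exact: contZ.
have int_ge0 (F : X -> R) : continuous F -> (forall p, 0 <= F p) -> 0 <= \int[mu]_p F p.
  move=> cF F0; have : \int[mu]_p (0 : R) <= \int[mu]_p F p.
    by apply: (Rint_le hmu) => // p; exact: cvg_cst.
  by rewrite Rint_cst mul0r.
(* Cauchy-Schwarz, from the integral of [(f - g)^2]; its equality case below forces [u1 = u0] and is
   served by [v = 0]. *)
have c1 : c <= 1.
  have : 0 <= 2 * Vol mu * (1 - c).
    by rewrite -Isub; apply: int_ge0 => // p; rewrite -expr2 sqr_ge0.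
  by rewrite pmulr_rge0 ?subr_ge0// mulr_gt0.
have c0 : 0 <= c.
  apply: divr_ge0 (ltW V0); apply: int_ge0 => [|p]; first exact: contM.
  by rewrite mulr_ge0 ?expR_ge0.
have [c1E|cn1] := eqVneq c 1.
  have u10 : u1 = u0.
    apply/funext => p.
    have : (1 * f p + (-1) * g p) * (1 * f p + (-1) * g p) = 0.
      apply: (Rint_eq0 hmu csub) => [q|]; first by rewrite -expr2 sqr_ge0.
      by rewrite Isub c1E subrr mulr0.
    move/eqP; rewrite mulf_eq0 orbb mul1r mulN1r subr_eq0 => /eqP /expR_inj /(mulIf _) H.
    by apply/esym/H; rewrite invr_eq0 pnatr_eq0.
  have sp0 : speed mu u0 (cst 0) = 0.
    rewrite /speed; have -> : calabi mu u0 (cst 0) (cst 0) = 0.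
      rewrite -[RHS](mul0r (Vol mu)) -Rint_cst; apply: eq_Rintegral => p _.
      by rewrite /cst !mul0r.
    by rewrite mul0r sqrtr0.
  have circ1 t p : circ mu u0 (cst 0) t p = 1.
    by rewrite /circ sp0 mul0r cos0 /cst mul0r mul0r addr0.
  exists (cst 0); split.
  - split.
      move=> d Xd k; have [_ oC _ _ _] := atlas_chart Xd; exact: class_C_cst.
    rewrite -[RHS](mul0r (Vol mu)) -Rint_cst; apply: eq_Rintegral => p _.
    by rewrite /cst mul0r.
  - by move=> t _ p; rewrite circ1.
  - by rewrite u10; apply/funext => p; rewrite /great_circle circ1 ln1 mulr0 addr0.
have clt1 : c < 1 by rewrite lt_neqAle cn1.
pose k := acos c.
have cI : -1 <= c <= 1 by rewrite c1 andbT (le_trans _ c0)// lerN10.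
have k0 : 0 < k by apply: acos_gt0; rewrite clt1 andbT (le_trans _ c0)// lerN10.
have kpi : k < pi by apply: acos_ltpi; rewrite c1 andbT (lt_le_trans _ c0)// ltrN10.
have ck : cos k = c by apply: acosK; rewrite in_itv.
have sk0 : 0 < sin k by apply: sin_gt0_pi; rewrite k0.
have skn0 : sin k != 0 by rewrite gt_eqF.
have kn0 : k != 0 by rewrite gt_eqF.
have sk2 : sin k ^+ 2 = 1 - c ^+ 2 by rewrite -(cos2Dsin2 k) ck; ring.
pose rho p := expR ((u1 p - u0 p) / 2).
have rhof p : rho p * f p = g p.
  by rewrite -expRD -mulrDl subrK.
(* The solution of [cos k + v / 2 * (sin k / k) = rho], the requirement that the circle of speed [k]
   reach [u1] at time [1]. *)
pose v p := 2 * k / sin k * (rho p + (- c)).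
have vf p : v p * f p = (- (2 * k / sin k * c)) * f p + (2 * k / sin k) * g p.
  by rewrite /v -rhof; ring.
have vT : tangent mu u0 v.
  split; first exact: smooth_fun_lin_expR.
  have := Rint_lin hmu (- (2 * k / sin k * c)) (2 * k / sin k) (contM cf cf) (contM cf cg).
  rewrite Iff Ifg => H.
  transitivity (- (2 * k / sin k * c) * Vol mu + 2 * k / sin k * (c * Vol mu)).
    rewrite -H; apply: eq_Rintegral => p _; rewrite -expR_half -/(f p).
    by rewrite mulrA vf; ring.
  by ring.
have spk : speed mu u0 v = k.
  have -> : speed mu u0 v = Num.sqrt (k ^+ 2).
    rewrite /speed; congr Num.sqrt.
    have -> : calabi mu u0 v v = 4 * k ^+ 2 * Vol mu.
      transitivity (\int[mu]_p (((- (2 * k / sin k * c)) * f p + (2 * k / sin k) * g p) *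
         ((- (2 * k / sin k * c)) * f p + (2 * k / sin k) * g p))).
        by apply: eq_Rintegral => p _; rewrite -vf -expR_half -/(f p); ring.
      rewrite (Rint_prod_lin hmu)// Iff Ifg Igg.
      transitivity (4 * k ^+ 2 * Vol mu * (1 - c ^+ 2) / sin k ^+ 2); first by field.
      by rewrite -sk2; field.
    by field.
  by rewrite sqrtr_sqr gtr0_norm.
(* Spherical linear interpolation: for times in [[0, 1]] both sines are nonnegative and at least one
   is positive. *)
have circE t p : circ mu u0 v t p = (sin (k * (1 - t)) + rho p * sin (k * t)) / sin k.
  by rewrite /circ spk mulrBr mulr1 sinB ck /v; field; rewrite skn0 kn0.
exists v; split=> //.
- move=> t; rewrite /= in_itv /= => /andP[t0 t1] p; rewrite circE divr_gt0//.
  have r0 : 0 < rho p by exact: expR_gt0.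
  have [->|tn1] := eqVneq t 1.
    by rewrite subrr mulr0 sin0 add0r mulr1 mulr_gt0.
  have tlt1 : t < 1 by rewrite lt_neqAle tn1.
  rewrite ltr_wpDr//; last first.
    apply: sin_gt0_pi; rewrite mulr_gt0 ?subr_gt0//=.
    by apply: le_lt_trans kpi; rewrite ger_pMr// gerBl.
  rewrite mulr_ge0 ?(ltW r0)//.
  apply: sin_ge0_pi; rewrite mulr_ge0 ?(ltW k0)//=.
  by apply: le_trans (ltW kpi); rewrite ger_pMr.
- apply/funext => p; rewrite /great_circle circE subrr mulr0 sin0 add0r mulr1 mulfK//.
  by rewrite expRK mulrC divfK ?pnatr_eq0// addrC subrK.
Qed.

End Exponential.

(** * The maximal interval around zero *)

Section MaximalInterval.
Context {R : realType}.

(** For [O] containing [0] this is its connected component of [0]; phrased by segments from [0], its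
    properties reduce to comparisons of reals. *)
Definition reach (O : set R) : set R :=
  [set t | forall s, Num.min 0 t <= s <= Num.max 0 t -> O s].

Lemma reach_open (O : set R) : open O -> open (reach O).
Proof.
move=> oO; rewrite openE => t Ot.
have /oO : O t by apply: Ot; rewrite ge_min le_max !lexx !orbT.
rewrite /interior => /nbhs_ballP[e /= e0 eO].
apply/nbhs_ballP; exists e => //= t'; rewrite /ball /= ltr_norml => /andP[h1 h2] s.
move=> /andP[]; rewrite ge_min le_max => s1 s2.
have [sb|] := boolP (Num.min 0 t <= s <= Num.max 0 t); first exact: Ot.
rewrite negb_and -!ltNge lt_min gt_max => /orP[] /andP[a b]; apply: eO;
  rewrite /ball /= ltr_norml.
- by case/orP: s1 => s1; lra.
- by case/orP: s2 => s2; lra.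
Qed.

Lemma reach_interval (O : set R) : is_interval (reach O).
Proof.
move=> x y Ox Oy z /andP[xz zy] s; rewrite ge_min le_max => /andP[s1 s2].
have [s0|s0] := leP 0 s.
- apply: Oy; rewrite ge_min le_max s0 /=.
  by case/orP: s2 => s2; apply/orP; [left|right]; lra.
- apply: Ox; rewrite ge_min le_max (ltW s0) andbT.
  by case/orP: s1 => s1; apply/orP; [left|right]; lra.
Qed.

Lemma reach_sub (O : set R) : reach O `<=` O.
Proof. by move=> t; apply; rewrite ge_min le_max !lexx !orbT. Qed.

Lemma sub_reach (O J : set R) : is_interval J -> J 0 -> J `<=` O -> J `<=` reach O.
Proof.
move=> intJ J0 JO t Jt s /andP[]; rewrite ge_min le_max => s1 s2; apply: JO.
have [t0|t0] := leP 0 t.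
  by apply: (intJ 0 t) => //; case/orP: s1; case/orP: s2 => *; apply/andP; split; lra.
by apply: (intJ t 0) => //; case/orP: s1; case/orP: s2 => *; apply/andP; split; lra.
Qed.

Lemma open_proper_interval (I : set R) : open I -> is_interval I -> I 0 ->
  proper_interval I.
Proof.
move=> oI intI I0; split=> //.
have /nbhs_ballP[e /= e0 eI] := open_nbhs_nbhs (conj oI I0).
exists 0, (e / 2); split=> //; last by lra.
by apply: eI; rewrite /ball /= sub0r normrN gtr0_norm; lra.
Qed.

End MaximalInterval.

Theorem theorem1p3 (R : realType) (n : nat) (X : closed_kahler R n)
    (mu : {measure set (borel X) -> \bar R}) (hmu : is_kahler_volume mu) :
  [/\ (forall u0 v0 : X -> R, calC mu u0 -> tangent mu u0 v0 ->
        exists (I : set R) (u : R -> X -> R),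
          [/\ open I,
              cauchy_solution mu u0 v0 I u,
              forall (J : set R) (w : R -> X -> R),
                cauchy_solution mu u0 v0 J w ->
                J `<=` I /\ (forall t, J t -> w t = u t),
              forall p : X, analytic_on I (fun t => u t p) &
              Vol mu = 1 / 4 -> calabi_norm mu u0 v0 = 1 ->
              forall t, I t -> forall p : X,
                0 < cos t + v0 p / 2 * sin t /\
                u t p = u0 p + 2 * ln (cos t + v0 p / 2 * sin t)]),
      (forall u0 : X -> R, calC mu u0 ->
        set_bij (exp_dom mu u0) (calC mu) (calabi_exp mu u0)) &
      (forall u0 u1 : X -> R, ~ conjugate_points mu u0 u1)].
Proof.
split.
- move=> u0 v0 u0C v0T.
  (* Any solution lives on an interval containing [0] on which [circ] is positive, hence inside
     [reach O]; this gives maximality. *)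
  pose O := [set t | [set: R] t /\ forall p, 0 < circ mu u0 v0 t p].
  have oO : open O.
    apply: smooth_in_gt0; first exact: openT.
    by apply: smooth_in_circ; [exact: openT|case: v0T].
  have I0 : reach O 0.
    move=> s; rewrite minxx maxxx => s0.
    have -> : s = 0 by apply/eqP; rewrite eq_le andbC.
    by split=> // p; rewrite circ0.
  have IO t : reach O t -> forall p, 0 < circ mu u0 v0 t p by move=> /reach_sub[].
  have oI := reach_open oO.
  exists (reach O), (great_circle mu u0 v0); split=> //.
  + apply: (great_circle_cauchy hmu u0C v0T) => //.
    exact: (open_proper_interval oI (@reach_interval _ O) I0).
  + move=> J w hw; split=> [|t Jt]; last by have [_ ->] := cauchy_great_circle hmu hw Jt.
    have [J0 [[[intJ _] _ _] _] _ _] := hw.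
    apply: sub_reach => // t Jt; split=> //.
    by have [] := cauchy_great_circle hmu hw Jt.
  + move=> p; apply: (@analytic_ln_sinusoid R (speed mu u0 v0) (reach O)
      (fun t => circ mu u0 v0 t p) (fun t => dcirc mu u0 v0 t p) (u0 p) oI).
    * by move=> t /IO.
    * by move=> t; exact: is_derive_circ.
    * by move=> t; exact: is_derive_dcirc.
  + move=> V14 n1 t It p.
    have sp1 : speed mu u0 v0 = 1.
      have four : 4 * (1 / 4) = 1 :> R by field.
      by rewrite /speed V14 four divr1; exact: n1.
    have cE : circ mu u0 v0 t p = cos t + v0 p / 2 * sin t.
      by rewrite /circ sp1 !mul1r divr1.
    by rewrite -cE; split=> //; exact: IO.
- move=> u0 u0C; split.
  + exact: calabi_exp_fun.
  + exact: calabi_exp_inj.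
  + exact: calabi_exp_surj.
- move=> u0 u1 [u0C u1C u01 [I [u [t0 [J [geo [I0 uu0] [It0 uu1]]]]]]].
  move=> [jac [t [p [It Jtp]]]] [J0 Jt0].
  have [[_ v0s] H] := geodesic_great_circle hmu geo I0.
  have [sv0 _] := (geodesic_great_circle hmu geo I0).1.
  have cu0 : continuous (u 0) by rewrite uu0; apply: smooth_fun_continuous; case: u0C.
  (* A geodesic of speed zero is constant and cannot join two distinct points. *)
  have beta0 : speed mu (u 0) (ddt I u 0) != 0.
    apply/eqP => b0; apply: u01; rewrite -uu0 -uu1; apply/funext => q.
    have [_ ->] := H t0 It0 q; rewrite /great_circle /circ b0.
    rewrite (speed0_eq0 hmu cu0 (smooth_fun_continuous sv0) b0) !mul0r cos0 addr0.
    by rewrite ln1 mulr0 addr0.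
  have t00 : t0 != 0 by apply/eqP => t0E; apply: u01; rewrite -uu0 -uu1 t0E.
  have [[_ [ O [w [oO IO sw wJ]]]] _] := jac.
  move/eqP: Jtp; apply.
  exact: (jacobi_eq0 hmu geo I0 jac beta0 oO IO sw wJ It0 t00 J0 Jt0).
Qed.
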